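(* Let $\mathfrak g$ be a symmetrizable Kac-Moody algebra over $\mathbb C$ with Weyl group $W$, and let $\pi$ be a path such that for every positive real root $\beta$: - either $H^\pi_\beta(t)\ge 0$ for all $t\in[0,1]$; - or there exists a real number $t^\pi_\beta\in[0,1)$ such that the function $H^\pi_\beta$ is nonnegative for $t\le t^\pi_\beta$, and is strictly negative and non-increasing for $t>t^\pi_\beta$. Then: (i) $\pi$ is an extremal path; (ii) if $w\in W$ is the element of smallest length such that $w\pi(1)$ is dominant, then $$I(w)=\{\beta\in R^+_{re}\ :\ H^\pi_\beta(1)<0\}.$$
   Context: $\mathfrak g$ is a symmetrizable Kac-Moody algebra over $\mathbb C$ with Cartan subalgebra $\mathfrak h$, weight lattice $X$, set of simple roots $S$, Weyl group $W$ with its length function, and set of positive real roots $R^+_{re}$. Put $X_{\mathbb R}=X\otimes_{\mathbb Z}\mathbb R$. For a real root $\beta$, $\beta^\vee\in X_{\mathbb R}^*$ is the associated coroot and $\langle\chi,\beta^\vee\rangle$ its value at $\chi$. The dominant chamber is $D=\{\chi\in X_{\mathbb R}:\langle\chi,\alpha^\vee\rangle\ge0\ \forall\alpha\in S\}$; elements of $X\cap D$ are the dominant weights. For $\lambda\in X\cap D$, $V(\lambda)$ is the integrable irreducible representation of highest weight $\lambda$; its extremal weights are the $u\lambda$, $u\in W$. For $w\in W$, the inversion set is $I(w)=\{\beta\in R^+_{re}: w\beta\in -R^+_{re}\}$. A path is a rectifiable (continuous) map $\pi:[0,1]\to X_{\mathbb R}$ with $\pi(0)=0$ and $\pi(1)\in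 X$. Paths are considered up to reparametrization: $\pi$ and $\pi'$ are identified if $\pi=\pi'\circ\phi$ with $\phi:[0,1]\to[0,1]$ non-decreasing, surjective and continuous. $\Pi$ is the set of paths (modulo this equivalence). A path is dominant if its image is contained in $D$. For a real root $\beta$, $H^\pi_\beta(t)=\langle\pi(t),\beta^\vee\rangle$, and $m^\pi_\beta=\min_{t\in[0,1]}H^\pi_\beta(t)$. Littelmann root operators: for $\alpha\in S$ put $$L^\pi_\alpha(t)=\min\big(\{1\}\cup\{H^\pi_\alpha(s)-m^\pi_\alpha: t\le s\le1\}\big),\qquad R^\pi_\alpha(t)=1-\min\big(\{1\}\cup\{H^\pi_\alpha(s)-m^\pi_\alpha:0\le s\le t\}\big).$$ $f_\alpha\pi$ is undefined if $L^\pi_\alpha(1)<1$, otherwise $(f_\alpha\pi)(t)=\pi(t)-L^\pi_\alpha(t)\alpha$. $e_\alpha\pi$ is undefined if $R^\pi_\alpha(0)>0$, otherwise $(e_\alpha\pi)(t)=\pi(t)+R^\pi_\alpha(t)\alpha$. For $\pi\in\Pi$, $B(\pi)$ is the smallest subset of $\Pi$ containing $\pi$ and stable under all $e_\alpha,f_\alpha$ ($\alpha\in S$) whenever defined. (For a dominant path $\pi$, it is known that $\pi$ is the unique dominant path of $B(\pi)$.) Extremal path: let $\eta$ be a path and let $\pi$ be the unique dominant path such that $\eta\in B(\pi)$; $\eta$ is called extremal if the weight $\eta(1)$ is an extremal weight of $V(\pi(1))$.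
   Formalization: The formal theorem additionally assumes that π lies in B(π₀) for some dominant path π₀, as the definition of extremal path presupposes; otherwise (i) fails, e.g. for the straight line to a weight of negative level in affine type. *)

(* Defs.v *)
From mathcomp Require Import all_boot all_order all_algebra.
From mathcomp Require Import all_classical all_reals all_analysis.

Set Implicit Arguments.
Unset Strict Implicit.
Unset Printing Implicit Defensive.

Import Order.TTheory GRing.Theory Num.Theory.
Import numFieldNormedType.Exports.

Local Open Scope classical_set_scope.
Local Open Scope ring_scope.

(* A Kac-Moody algebra over C is given by a generalized Cartan matrix together
   with a realization (h, simple roots, simple coroots).  We fix a Z-basis of
   the weight lattice X: X is 'cV[int]_r, its dual is 'rV[int]_r, X_R is
   'cV[R]_r, and h is C (x) Hom(X, Z), so that dim h = r. *)
Record kac_moody (n r : nat) := KacMoody {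
  cartan : 'M[int]_n;
  sroot : 'I_n -> 'cV[int]_r;
  scoroot : 'I_n -> 'rV[int]_r;
  cartan_diag : forall i, cartan i i = 2;
  cartan_offdiag : forall i j, i != j -> cartan i j <= 0;
  cartan_zero : forall i j, cartan i j = 0 -> cartan j i = 0;
  cartan_pairing : forall i j, (scoroot i *m sroot j) 0 0 = cartan i j;
  (* dim h = 2 n - rank A *)
  realization_dim :
    (r + \rank (map_mx intr cartan : 'M[rat]_n) = 2 * n)%N;
  sroot_free : forall c : 'I_n -> int,
    \sum_i c i *: sroot i = 0 -> forall i, c i = 0;
  (* X contains fundamental weights; in particular the simple coroots are
     linearly independent *)
  fundamental_weights : exists omega : 'I_n -> 'cV[int]_r,
    forall i j, (scoroot i *m omega j) 0 0 = (i == j)%:R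
}.

Definition symmetrizable n r (g : kac_moody n r) : Prop :=
  exists d : 'rV[int]_n, (forall i, 0 < d 0 i) /\
    (diag_mx d *m cartan g)^T = diag_mx d *m cartan g.

Section WeylGroup.
Variables (n r : nat) (g : kac_moody n r).

(* chi |-> chi - <chi, alpha_i^vee> alpha_i *)
Definition srefl (i : 'I_n) : 'M[int]_r := 1%:M - sroot g i *m scoroot g i.

Definition word_elt (s : seq 'I_n) : 'M[int]_r :=
  foldr (fun i w => srefl i *m w) 1%:M s.

(* Simple reflections are involutions, so the words in them form a group. *)
Definition weyl : set 'M[int]_r := range word_elt.

Definition is_length (w : 'M[int]_r) (k : nat) : Prop :=
  (exists2 s, size s = k & word_elt s = w) /\
  (forall s, word_elt s = w -> (k <= size s)%N).

Definition weyl_length (w : 'M[int]_r) : nat := xget 0%N (is_length w).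

Definition real_root : set 'cV[int]_r :=
  [set b | exists w i, weyl w /\ b = w *m sroot g i].

Definition pos_real_root : set 'cV[int]_r :=
  [set b | real_root b /\
    exists c : 'I_n -> nat, b = \sum_i (c i)%:Z *: sroot g i].

(* If b = w alpha_i then b^vee = w alpha_i^vee, that is alpha_i^vee o w^-1;
   this depends only on b. *)
Definition is_coroot (b : 'cV[int]_r) (bv : 'rV[int]_r) : Prop :=
  exists w i, [/\ weyl w, b = w *m sroot g i & bv = scoroot g i *m invmx w].

Definition coroot (b : 'cV[int]_r) : 'rV[int]_r := xget 0 (is_coroot b).

Definition inversion_set (w : 'M[int]_r) : set 'cV[int]_r :=
  [set b | pos_real_root b /\ pos_real_root (- (w *m b))].

End WeylGroup.

Section Paths.
Variables (R : realType) (n r : nat) (g : kac_moody n r).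
Local Notation XR := 'cV[R]_r.

Definition toXR (x : 'cV[int]_r) : XR := map_mx intr x.

Definition pairing (x : XR) (bv : 'rV[int]_r) : R :=
  (map_mx intr bv *m x) 0 0.

Definition weyl_act (w : 'M[int]_r) (x : XR) : XR := map_mx intr w *m x.

Definition dominant (x : XR) : Prop := forall i, 0 <= pairing x (scoroot g i).

(* mu is an extremal weight of V(la), la being a dominant weight *)
Definition extremal_weight (la mu : XR) : Prop :=
  exists2 u, weyl g u & mu = weyl_act u la.

Definition rectifiable (p : R -> XR) : Prop :=
  exists M : R, forall s : seq R, itv_partition 0 1 s ->
    let q := p \o nth 1 (0 :: s) in
    \sum_(0 <= k < size s) `|q k.+1 - q k| <= M.

(* A path is represented by a function on R of which only the restriction to
   [0, 1] matters. *)
Definition is_path (p : R -> XR) : Prop :=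
  [/\ {within `[0, 1], continuous p}, rectifiable p, p 0 = 0
    & exists x : 'cV[int]_r, p 1 = toXR x].

Definition is_reparam (phi : R -> R) : Prop :=
  [/\ {in `[0, 1] &, {homo phi : s t / s <= t}},
      phi @` `[0, 1]%classic = `[0, 1]%classic
    & {within `[0, 1], continuous phi}].

Definition reparametrizes (p p' : R -> XR) : Prop :=
  exists2 phi, is_reparam phi & {in `[0, 1], forall t, p t = p' (phi t)}.

Definition dominant_path (p : R -> XR) : Prop :=
  {in `[0, 1], forall t, dominant (p t)}.

Definition Hfun (p : R -> XR) (b : 'cV[int]_r) (t : R) : R :=
  pairing (p t) (coroot g b).

Definition Hmin (p : R -> XR) (b : 'cV[int]_r) : R :=
  inf [set Hfun p b t | t in `[0, 1]%classic].

Definition f_coef (p : R -> XR) (i : 'I_n) (t : R) : R :=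
  let a := sroot g i in
  inf (1 |` [set Hfun p a s - Hmin p a | s in `[t, 1]%classic]).

Definition e_coef (p : R -> XR) (i : 'I_n) (t : R) : R :=
  let a := sroot g i in
  1 - inf (1 |` [set Hfun p a s - Hmin p a | s in `[0, t]%classic]).

Definition f_defined (p : R -> XR) (i : 'I_n) : Prop := ~ (f_coef p i 1 < 1).
Definition f_op (i : 'I_n) (p : R -> XR) (t : R) : XR :=
  p t - f_coef p i t *: toXR (sroot g i).

Definition e_defined (p : R -> XR) (i : 'I_n) : Prop := ~ (0 < e_coef p i 0).
Definition e_op (i : 'I_n) (p : R -> XR) (t : R) : XR :=
  p t + e_coef p i t *: toXR (sroot g i).

(* [crystal p q] says that the class of q belongs to B(p).  The two
   reparametrization clauses make the set of such q a union of classes of the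
   equivalence relation generated by [reparametrizes]. *)
Inductive crystal (p : R -> XR) : (R -> XR) -> Prop :=
| crystal_self : crystal p p
| crystal_reparam q q' :
    crystal p q -> reparametrizes q' q -> crystal p q'
| crystal_unreparam q q' :
    crystal p q -> reparametrizes q q' -> crystal p q'
| crystal_f i q : crystal p q -> f_defined q i -> crystal p (f_op i q)
| crystal_e i q : crystal p q -> e_defined q i -> crystal p (e_op i q).

(* p is a dominant path with q in B(p).  Such a p is unique up to
   reparametrization, but need not exist in infinite type: take for q the
   straight line to a weight outside the Tits cone. *)
Definition dominant_source (q p : R -> XR) : Prop :=
  [/\ is_path p, dominant_path p & crystal p q].

Definition extremal_path (q : R -> XR) : Prop :=
  exists2 p, dominant_source q p & extremal_weight (p 1) (q 1).

(* w is of smallest length among the elements of W sending x into the dominant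
   chamber *)
Definition min_dominating (x : XR) (w : 'M[int]_r) : Prop :=
  [/\ weyl g w, dominant (weyl_act w x)
    & forall v, weyl g v -> dominant (weyl_act v x) ->
        (weyl_length g w <= weyl_length g v)%N].

End Paths.

(* Main.v *)
Require Import Defs.
From HB Require Import structures.
From mathcomp Require Import all_boot all_order all_algebra.
From mathcomp Require Import all_classical all_reals all_analysis.
From mathcomp Require Import ring lra zify.

(* If [p] is not dominant, then [H_i(1) < 0] for a simple root [alpha_i].
   Folding [p], that is applying [e_i] as often as possible, replaces [p] by
   [s_i p] where [H_i] is negative; the sign conditions survive.  Iterating,
   one reaches a dominant path, and [p 1] is in the Weyl orbit of its endpoint,
   provided the procedure stops.

   It stops because [p] lies in [B(p0)] with [p0] dominant, so that the number
   of steps is at most the height of [p0 1 - p 1]; the point is to show that this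
   height is nonnegative for every path of [B(p0)].  To a path [q] associate the
   infimum of [H_{i_1}(t_1) + ... + H_{i_k}(t_k)] over [1 >= t_1 >= ... >= t_k >= 0]
   and over the words with [f_{i_k} ... f_{i_1} v <> 0] in the irreducible
   module with highest weight vector [v] and highest weight the sum of the
   fundamental coweights.  It is at most 0 (empty word), it is 0 if [q] is
   dominant, and [e_i] raises it by exactly 1, by a computation with one copy of
   sl2.

   The weights of such modules are stable under the Weyl group, which
   gives that real roots have coefficients of constant sign.  The second claim
   then follows from the exchange condition. *)

Set Implicit Arguments.
Unset Strict Implicit.
Unset Printing Implicit Defensive.

Import Order.TTheory GRing.Theory Num.Theory.
Import numFieldNormedType.Exports.

Local Open Scope classical_set_scope.
Local Open Scope ring_scope.

(** * The representation theory of sl2 *)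

(** Since [crystal] is closed under both kinds of operators, nothing in its definition prevents a
    path of B(p0) from lying above p0; an invariant is needed that follows every operator exactly.
    Over all words the infimum would be minus infinity as soon as one height is negative somewhere,
    by repeating one letter at that time. Nonvanishing in an integrable module bounds the
    repetitions, and this bound balances the change of the heights under [e_i]: at a letter [j] the
    change is proportional to a Cartan integer, and summed over a word these integers give the
    weight of the vector reached. Only the set of nonzero monomials matters. The sl2 lemmas say that
    one vector lies in the span of others; [submodule_pred] encodes the span by an arbitrary
    predicate closed under linear combinations. With the kernel of a word as predicate, one nonzero
    monomial yields another. As [e_i] alters a whole range of times, the passage from [q] to [e_i q]
    is cut into shifts whose time windows contain no letter other than [i]. *)

Definition submodule_pred (K : pzRingType) (V : lmodType K) (Z : V -> Prop) :=
  forall a x y, Z x -> Z y -> Z (a *: x + y).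

Section Sl2.
Variables (K : numFieldType) (V : lmodType K) (E F H : {linear V -> V}).
Hypothesis EF : forall x, E (F x) = F (E x) + H x.
Hypothesis HE : forall x, H (E x) = E (H x) + 2 *: E x.
Hypothesis HF : forall x, H (F x) = F (H x) - 2 *: F x.

Lemma sl2_wtE y g : H y = g *: y -> H (E y) = (g + 2) *: E y.
Proof. by move=> Hy; rewrite HE Hy linearZ scalerDl. Qed.

Lemma sl2_wtF y g : H y = g *: y -> H (F y) = (g - 2) *: F y.
Proof. by move=> Hy; rewrite HF Hy linearZ scalerBl. Qed.

Lemma sl2_wt_iterF y g m :
  H y = g *: y -> H (iter m F y) = (g - m%:R * 2) *: iter m F y.
Proof.
move=> Hy; elim: m => [|m IH]; first by rewrite mul0r subr0.
by rewrite iterS (sl2_wtF IH); congr (_ *: _); rewrite -natr1; ring.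
Qed.

Lemma sl2_E_iterF y g m : H y = g *: y ->
  E (iter m.+1 F y) = iter m.+1 F (E y) + (m.+1%:R * (g - m%:R)) *: iter m F y.
Proof.
move=> Hy; elim: m => [|m IH].
  by rewrite /= EF Hy; congr (_ + _ *: _); ring.
rewrite iterS EF IH linearD linearZ (sl2_wt_iterF m.+1 Hy) -addrA.
by congr (_ + _); rewrite -!iterS -scalerDl; congr (_ *: _); rewrite -!natr1; ring.
Qed.

Lemma iter_lin (f : {linear V -> V}) (m : nat) a x y :
  iter m f (a *: x + y) = a *: iter m f x + iter m f y.
Proof. by elim: m => //= m ->; rewrite linearP. Qed.

Lemma iter_lin0 (f : {linear V -> V}) m : iter m f 0 = 0.
Proof. by elim: m => //= m ->; rewrite linear0. Qed.

Lemma iter_linZ (f : {linear V -> V}) m a x : iter m f (a *: x) = a *: iter m f x.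
Proof. by elim: m => //= m ->; rewrite linearZ. Qed.

Lemma submodule_pred_iter (Z : V -> Prop) (f : {linear V -> V}) m :
  submodule_pred Z -> submodule_pred (fun x => Z (iter m f x)).
Proof. by move=> HZ a x y Zx Zy; rewrite iter_lin; apply: HZ. Qed.

Lemma submoduleD (Z : V -> Prop) x y :
  submodule_pred Z -> Z x -> Z y -> Z (x + y).
Proof. by move=> HZ Zx Zy; rewrite -[x]scale1r; apply: HZ. Qed.

Lemma submoduleZ (Z : V -> Prop) a x : submodule_pred Z -> Z x -> Z (a *: x).
Proof.
move=> HZ Zx; rewrite -[_ *: _]addr0; apply: (HZ) => //.
by have := HZ (-1) x x Zx Zx; rewrite scaleN1r addNr.
Qed.

(* [F^m y] lies in the span of the [E^(N - m) F^N y] with [N >= h]. *)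
Lemma sl2_raise (Z : V -> Prop) (r h m : nat) y : submodule_pred Z ->
  iter r E y = 0 -> H y = h%:R *: y -> (m <= h)%N ->
  (forall N, (h <= N)%N -> Z (iter (N - m) E (iter N F y))) ->
  Z (iter m F y).
Proof.
elim: r h m y Z => [|r IH] h m y Z HZ.
  by move=> /= -> Hy mh /(_ h (leqnn h)); rewrite !iter_lin0.
rewrite iterSr => Er Hy mh Zgen.
have Hy' : H (E y) = (h.+2)%:R *: E y.
  by rewrite (sl2_wtE Hy); congr (_ *: _); rewrite -!natr1; ring.
(* [E y] has weight [h + 2] and smaller nilpotency order. Its generators come from those of [y],
   since [iter M F (E y)] is [E (iter M F y)] up to a multiple of [iter (M - 1) F y]. *)
have ZE M : (h.+2 <= M)%N -> Z (iter (M - m.+1) E (iter M F (E y))).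
  case: M => // M hM.
  have := sl2_E_iterF M Hy; move/esym/(canRL (addrK _)) => ->.
  rewrite -scaleNr addrC iter_lin; apply: (HZ).
    by rewrite subSS; apply: Zgen; lia.
  rewrite subSS -iterSr; have -> : ((M - m).+1 = M.+1 - m)%N by lia.
  by apply: Zgen; lia.
have ZE' N : (m.+1 <= N <= h.+2)%N -> Z (iter (N - m.+1) E (iter N F (E y))).
  move=> /andP[mN Nh].
  apply: (IH h.+2 N (E y) (fun x => Z (iter (N - m.+1) E x))) => //.
    exact: submodule_pred_iter HZ.
  move=> M hM; rewrite -iterD.
  have -> : (N - m.+1 + (M - N) = M - m.+1)%N by lia.
  by apply: ZE.
have step k : (k <= h - m)%N -> Z (iter (h - k - m) E (iter (h - k) F y)).
  elim: k => [|k IHk] kh; first by rewrite subn0; apply: Zgen.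
  have {IHk} := IHk (leq_trans (leqnSn k) kh).
  have -> : (h - k = (h - k.+1).+1)%N by lia.
  set M := (h - k.+1)%N => ZM.
  (* The coefficient of [iter M F y] in [E (iter M.+1 F y)] is nonzero for [M < h], so the powers
     below [h] are recovered one by one from the next higher one. *)
  have cN0 : M.+1%:R * (h%:R - M%:R) != 0 :> K.
    rewrite mulf_neq0 ?pnatr_eq0 // subr_eq0 eqr_nat; lia.
  have eq1 := sl2_E_iterF M Hy; set c := M.+1%:R * _ in cN0 eq1.
  have -> : iter M F y = (- c^-1) *: iter M.+1 F (E y) + c^-1 *: E (iter M.+1 F y).
    by rewrite eq1 scalerDr scalerA mulVf // scale1r scaleNr addrA addNr add0r.
  rewrite iter_lin; apply: (HZ).
    have -> : (M - m = M.+1 - m.+1)%N by lia.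
    by apply: ZE'; lia.
  have -> : iter (M - m) E (c^-1 *: E (iter M.+1 F y)) =
            c^-1 *: iter (M.+1 - m) E (iter M.+1 F y).
    rewrite iter_linZ -iterSr.
    by have -> : (M.+1 - m = (M - m).+1)%N by lia.
  exact: submoduleZ.
have := step (h - m)%N (leqnn _).
have -> : (h - (h - m) = m)%N by lia.
by rewrite subnn.
Qed.

(** Normal ordering: each [E] either crosses all the [F] or is absorbed with one of them into a
    scalar. *)
Lemma sl2_EF_expand (Z : V -> Prop) (N m : nat) g y : submodule_pred Z ->
  H y = g *: y ->
  (forall i, (N <= m + i)%N -> (i <= N)%N -> Z (iter (m + i - N) F (iter i E y))) ->
  Z (iter N E (iter m F y)).
Proof.
elim: N m g y Z => [|N IH] m g y Z HZ Hy Zgen.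
  by have := Zgen 0%N; rewrite addn0 subn0; apply.
rewrite iterSr; case: m Zgen => [|m] Zgen.
  by rewrite -iterSr; have := Zgen N.+1; rewrite add0n subnn; apply.
rewrite (sl2_E_iterF m Hy) addrC iter_lin; apply: (HZ).
  apply: (IH m g) => // i Ni iN.
  have := Zgen i.
  have -> : (m.+1 + i - N.+1 = m + i - N)%N by lia.
  by apply; lia.
apply: (IH m.+1 (g + 2)) => //; first exact: sl2_wtE.
move=> i Ni iN; have := Zgen i.+1.
by rewrite addnS subSS iterSr; apply; lia.
Qed.

End Sl2.

Section Sl2Mirror.
Variables (K : numFieldType) (V : lmodType K) (E F H : {linear V -> V}).
Hypothesis EF : forall x, E (F x) = F (E x) + H x.
Hypothesis HE : forall x, H (E x) = E (H x) + 2 *: E x.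
Hypothesis HF : forall x, H (F x) = F (H x) - 2 *: F x.

Let H' : {linear V -> V} := \- H.

(** Exchanging [E] with [F] and [H] with [- H] preserves the sl2 relations. *)
Lemma sl2_raise_mirror (Z : V -> Prop) (r h m : nat) y : submodule_pred Z ->
  iter r F y = 0 -> H y = - h%:R *: y -> (m <= h)%N ->
  (forall N, (h <= N)%N -> Z (iter (N - m) F (iter N E y))) ->
  Z (iter m E y).
Proof.
move=> HZ Fr Hy mh Zgen.
apply: (@sl2_raise K V F E H' _ _ _ Z r h m y) => // [x|x|x|].
- by rewrite /= EF addrK.
- by rewrite /= HF linearN opprB addrC.
- by rewrite /= HE linearN opprD.
- by rewrite /= Hy scaleNr opprK.
Qed.

(* [F^m y] lies in the span of the [F^(m + i) E^i y] with [i >= m - g]. *)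
Lemma sl2_lower (Z : V -> Prop) (r m : nat) (g : int) y : submodule_pred Z ->
  iter r F y = 0 -> H y = g%:~R *: y -> g < m%:Z ->
  (forall i, m%:Z - g <= i%:Z -> Z (iter (m + i) F (iter i E y))) ->
  Z (iter m F y).
Proof.
move=> HZ Fr Hy gm Zgen.
(* [- h] is the weight of [iter m F y]; the mirrored lemma is applied to this vector with exponent
   0. *)
have [h hE] : exists h : nat, h%:Z = (2 * m)%:Z - g by exists `|(2 * m)%:Z - g|%N; lia.
apply: (@sl2_raise_mirror Z r h 0 (iter m F y)) => //.
- rewrite -iterD addnC iterD Fr; elim: (m) => //= k ->; exact: linear0.
- rewrite (sl2_wt_iterF HF m Hy); congr (_ *: _).
  have -> : g = (2 * m)%:Z - h%:Z by lia.
  rewrite intrB -!pmulrn natrM; ring.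
move=> N hN; rewrite subn0.
apply: (sl2_EF_expand (Z := fun x => Z (iter N F x)) EF HE HF _ Hy) => [|i Ni iN].
  exact: submodule_pred_iter HZ.
rewrite -iterD.
have -> : (N + (m + i - N) = m + i)%N by lia.
by apply: Zgen; lia.
Qed.

End Sl2Mirror.


(** * A highest weight module *)
Section HighestWeightModule.
Variables (I : eqType) (a : I -> I -> int) (c : I -> nat).

Local Notation V := (seq I -> rat^o).

Definition hwt (i : I) (l : seq I) : int := (c i)%:Z - \sum_(j <- l) a i j.

(* The dual Verma module: [x (l_1 :: ... :: l_k)] stands for the coefficient of
   [hwv] in [e_{l_k} ... e_{l_1} x].  Its submodule generated by [hwv] is
   irreducible, so that no quotient is needed. *)
Definition eop (i : I) (x : V) : V := fun l => x (i :: l).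

Definition hop (i : I) (x : V) : V := fun l => @GRing.mul rat (hwt i l)%:~R (x l).

(** Forced by [e_j f_i = f_i e_j + delta_ij h_i]: the coefficient of [f_i x] at [j :: l'] is that of
    [e_j (f_i x)] at [l']. At the empty word it is 0, as [f_i] lowers the weight. *)
Fixpoint fop_at (i : I) (x : V) (l : seq I) : rat :=
  if l is j :: l' then
    (if i == j then hop i x l' else 0) + fop_at i (eop j x) l'
  else 0.

Definition fop (i : I) (x : V) : V := fop_at i x.

Definition hwv : V := fun l => (l == [::])%:R.

Definition wvec (w : seq I) : V := foldr fop hwv w.

Lemma lin_at (k : rat) (x y : V) l : (k *: x + y) l = k * x l + y l :> rat.
Proof. by []. Qed.

Lemma add_at (x y : V) l : (x + y) l = x l + y l :> rat.
Proof. by []. Qed.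

Lemma sub_at (x y : V) l : (x - y) l = x l - y l :> rat.
Proof. by []. Qed.

Lemma opp_at (x : V) l : (- x) l = - x l :> rat.
Proof. by []. Qed.

Lemma scale_at (k : rat) (x : V) l : (k *: x) l = k * x l :> rat.
Proof. by []. Qed.

Definition vecE := (add_at, opp_at, scale_at).

Lemma eop_linear i : linear (eop i).
Proof. by []. Qed.

Lemma hop_linear i : linear (hop i).
Proof.
move=> k x y; apply/funext => l; rewrite /hop.
by rewrite !lin_at /=; ring.
Qed.

Lemma fop_linear i : linear (fop i).
Proof.
move=> k x y; apply/funext => l; rewrite lin_at.
elim: l x y => [|j l IH] x y; first by rewrite /fop /= mulr0.
rewrite /fop /= -!/(fop i _ _) eop_linear IH.
by case: eqP => _; rewrite ?hop_linear ?lin_at; ring.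
Qed.

HB.instance Definition _ i := GRing.isLinear.Build rat V V _ (eop i) (eop_linear i).
HB.instance Definition _ i := GRing.isLinear.Build rat V V _ (hop i) (hop_linear i).
HB.instance Definition _ i := GRing.isLinear.Build rat V V _ (fop i) (fop_linear i).

Lemma eop_fop i j x :
  eop j (fop i x) = fop i (eop j x) + (if i == j then hop i x else 0).
Proof. by apply/funext => l; rewrite add_at addrC {1}/eop /fop /=; case: eqP. Qed.

Lemma hop_eop i j x : hop i (eop j x) = eop j (hop i x) + (a i j)%:~R *: eop j x.
Proof.
apply/funext => l.
rewrite add_at scale_at.
by rewrite /hop /eop /hwt big_cons !rmorphB rmorphD /=; ring.
Qed.

Lemma hop_fop i j x : hop i (fop j x) = fop j (hop i x) - (a i j)%:~R *: fop j x.
Proof.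
apply/funext => l.
rewrite sub_at scale_at.
elim: l x => [|k l IH] x; first by rewrite /hop /fop /= !mulr0 subr0.
rewrite {1}/hop /fop /= -!/(fop j _ _).
have -> : eop k (hop i x) = - (a i k)%:~R *: eop k x + hop i (eop k x).
  by rewrite hop_eop addrCA scaleNr addNr addr0.
rewrite fop_linear lin_at.
have {IH} := IH (eop k x); rewrite {1}/hop => /esym/(canRL (subrK _)) ->.
have -> : hwt i (k :: l) = hwt i l - a i k.
  by rewrite /hwt big_cons opprD addrA addrAC.
rewrite rmorphB /=.
by case: eqP => [->|_]; rewrite /hop; ring.
Qed.

Lemma eop_hwv i : eop i hwv = 0.
Proof. by []. Qed.

Lemma hop_wvec i w : hop i (wvec w) = (hwt i w)%:~R *: wvec w.
Proof.
elim: w => [|j w IH].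
  apply/funext => l; rewrite /hop /= /hwv scale_at.
  by case: eqP => [->//|_]; rewrite !mulr0.
rewrite /= hop_fop -/(wvec w) IH linearZ -scalerBl /hwt big_cons -rmorphB /=.
by congr (_%:~R *: _); ring.
Qed.

(** Each [fop] lengthens the words of the support by one letter; this gradation makes every [eop]
    nilpotent on monomials. *)
Lemma wvec_size w l : wvec w l != 0 -> size l = size w.
Proof.
have fsz i (x : V) m : (forall l, x l != 0 -> size l = m) ->
    forall l, fop i x l != 0 -> size l = m.+1.
  move=> xm l'; elim: l' x m xm => [|j l' IH] x m xm; first by rewrite eqxx.
  rewrite /fop /= -/(fop i _ _) => nz; congr _.+1.
  have [z|nz'] := eqVneq (fop i (eop j x) l') 0; last first.
    case: m xm => [|m] xm; last by apply: (IH (eop j x)) => // l1 /xm /= [].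
    (* For [m = 0] the vector [eop j x] is zero, hence supported in every length, and [size l']
       would equal every successor. *)
    have /(_ (size l')) : forall k, size l' = k.+1.
      by move=> k; apply: (IH (eop j x)) => // l1 /xm.
    by move/eqP; rewrite -[X in X == _]addn0 -addn1 eqn_add2l.
  move: nz; rewrite z addr0; case: ifP => _; last by move/eqP.
  by rewrite /hop mulf_eq0 negb_or => /andP[_ /xm].
elim: w l => [|i w IH] l; first by rewrite /= /hwv; case: l.
exact: fsz.
Qed.

Lemma eop_nilp i w : iter (size w).+1 (eop i) (wvec w) = 0.
Proof.
apply/funext => l.
have -> : forall k (x : V) m, iter k (eop i) x m = x (ncons k i m).
  by elim=> // k IH x m; rewrite iterSr IH.
apply/eqP/negPn/negP => /wvec_size.
rewrite size_ncons; lia.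
Qed.

Hypothesis a_diag : forall i, a i i = 2.
Hypothesis a_offdiag : forall i j, i != j -> a i j <= 0.
Hypothesis a_zero : forall i j, a i j = 0 -> a j i = 0.

(* The Serre relations hold because [ad(f_i)^(1 - a_ij) f_j] commutes with all
   the [e_k] and vanishes at the empty word. *)
Section Serre.
Variables (i j : I).
Hypothesis ij : i != j.

Fixpoint adf (k : nat) (x : V) : V :=
  if k is k'.+1 then fop i (adf k' x) - adf k' (fop i x) else fop j x.

Lemma adf_linear k : linear (adf k).
Proof.
elim: k => [|k IH] t x y /=; first exact: fop_linear.
rewrite IH !fop_linear IH; apply/funext => l.
by rewrite !vecE; ring.
Qed.

HB.instance Definition _ k := GRing.isLinear.Build rat V V _ (adf k) (adf_linear k).

Lemma adfS k x : adf k.+1 x = fop i (adf k x) - adf k (fop i x).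
Proof. by []. Qed.

Arguments adf : simpl never.

Lemma hop_adf k x :
  hop i (adf k x) = adf k (hop i x) - (a i j + (2 * k)%:Z)%:~R *: adf k x.
Proof.
elim: k x => [|k IH] x; first by rewrite /adf hop_fop muln0 addr0.
rewrite !adfS linearB /= hop_fop !IH hop_fop a_diag !linearB /= !linearZ /=.
have -> : (2 * k.+1)%:Z = (2 * k)%:Z + 2 by lia.
by apply/funext => l; rewrite !vecE !rmorphD /=; ring.
Qed.

Lemma eop_adf_other l k x : l != i -> l != j -> eop l (adf k x) = adf k (eop l x).
Proof.
move=> li lj; have ff m z : l != m -> eop l (fop m z) = fop m (eop l z).
  by move=> lm; rewrite eop_fop eq_sym (negPf lm) addr0.
elim: k x => [|k IH] x; first exact: ff.
by rewrite !adfS linearB /= ff // !IH ff.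
Qed.

(** The scalar vanishes at [k = - a i j], one less than the exponent of the Serre relation. *)
Lemma eop_adfl k x : eop i (adf k.+1 x) =
  adf k.+1 (eop i x) + (k.+1%:Z * (- a i j - k%:Z))%:~R *: adf k x.
Proof.
have ei0 z : eop i (fop j z) = fop j (eop i z).
  by rewrite eop_fop eq_sym (negPf ij) addr0.
have eii z : eop i (fop i z) = fop i (eop i z) + hop i z by rewrite eop_fop eqxx.
elim: k x => [|k IH] x.
  rewrite !adfS linearB /= /adf eii !ei0 eii linearD hop_fop /= mul1r subr0.
  by apply/funext => l; rewrite !vecE !rmorphN /=; ring.
have TD y z : adf k.+1 (y + z) = adf k.+1 y + adf k.+1 z := linearD (adf k.+1) y z.
have fD y t z : fop i (y + t *: z) = fop i y + t *: fop i z.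
  by rewrite linearD /= linearZ.
rewrite adfS linearB /= eii hop_adf !IH eii TD fD [adf k.+2 _]adfS.
have -> : adf k (fop i x) = fop i (adf k x) - adf k.+1 x.
  by rewrite adfS opprB addrC subrK.
have -> : (2 * k.+1)%:Z = 2 * k%:Z + 2 by lia.
have -> : k.+2%:Z = k%:Z + 2 by lia.
have -> : k.+1%:Z = k%:Z + 1 by lia.
move: (adf k.+1) (adf k) => T T'.
by apply/funext => l; rewrite !vecE !(rmorphD, rmorphN, rmorphM) /=; ring.
Qed.

Lemma eop_adf1r x : eop j (adf 1 x) = adf 1 (eop j x) + (a j i)%:~R *: fop i x.
Proof.
have eji z : eop j (fop i z) = fop i (eop j z) by rewrite eop_fop (negPf ij) addr0.
have ejj z : eop j (fop j z) = fop j (eop j z) + hop j z by rewrite eop_fop eqxx.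
rewrite !adfS linearB /adf /= eji !ejj eji linearD /= hop_fop.
by apply/funext => l; rewrite !vecE; ring.
Qed.

(** The remainder in [eop_adf1r] is a multiple of [f_i], and one more commutator with [f_i] kills
    it. *)
Lemma eop_adfr k x : eop j (adf k.+2 x) = adf k.+2 (eop j x).
Proof.
have eji z : eop j (fop i z) = fop i (eop j z) by rewrite eop_fop (negPf ij) addr0.
elim: k x => [|k IH] x.
  rewrite adfS linearB /= eji !eop_adf1r eji linearD /= linearZ /= [adf 2 _]adfS.
  by apply/funext => l; rewrite !vecE; ring.
by rewrite [adf k.+3 x]adfS linearB /= eji !IH eji.
Qed.

Lemma adf_nil k x : adf k x [::] = 0.
Proof.
elim: k x => [//|k IH] x; rewrite adfS vecE opp_at IH subr0.
by [].
Qed.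

Lemma serre x : adf `|a i j|.+1 x = 0.
Proof.
set m := `|a i j|%N.
have aij : a i j = - m%:Z by have := a_offdiag ij; rewrite /m; lia.
have comm l z : eop l (adf m.+1 z) = adf m.+1 (eop l z).
  have [->|li] := eqVneq l i.
    by rewrite eop_adfl aij opprK subrr mulr0 scale0r addr0.
  have [->|lj] := eqVneq l j; last exact: eop_adf_other.
  (* For [a i j = 0] the relation is a single commutator, and the remaining term has the factor
     [a j i], zero by [a_zero]. *)
  case: (m) aij => [|k] aij; last exact: eop_adfr.
  by rewrite eop_adf1r (a_zero aij) scale0r addr0.
apply/funext => l; elim: l x => [|l0 l IH] x; first exact: adf_nil.
by rewrite -[LHS]/(eop l0 (adf m.+1 x) l) comm IH.
Qed.

(** Each [f_i] moved past [adf k] either increases [k], which [serre] bounds, or reaches [x], which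
    [M] bounds. *)
Lemma fop_nilp_step M x : iter M (fop i) x = 0 ->
  iter (M + `|a i j|.+1) (fop i) (fop j x) = 0.
Proof.
set m := `|a i j|.+1.
(* [d] is the number of commutators still missing before [serre] applies. *)
suff H d : (d <= m)%N -> forall M x, iter M (fop i) x = 0 ->
    iter (M + d) (fop i) (adf (m - d) x) = 0.
  by move=> Mx; have := H m (leqnn m) M x Mx; rewrite subnn.
elim: d => [|d IHd] dm {}M {}x; first by rewrite subn0 serre iter_lin0.
elim: M x => [|M IHM] x; first by move=> x0; rewrite (x0 : x = 0) linear0 iter_lin0.
rewrite iterSr => Mx.
have -> : (M.+1 + d.+1 = (M.+1 + d).+1)%N by lia.
rewrite iterSr.
have -> : fop i (adf (m - d.+1) x) =
    1 *: adf (m - d) x + adf (m - d.+1) (fop i x).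
  have -> : (m - d = (m - d.+1).+1)%N by lia.
  by rewrite adfS scale1r subrK.
rewrite iter_lin IHd ?(ltnW dm) // ?iterSr // scaler0 add0r.
by have := IHM _ Mx; rewrite addnS iterSr.
Qed.

End Serre.

Lemma sl2_eop_fop i x : eop i (fop i x) = fop i (eop i x) + hop i x.
Proof. by rewrite eop_fop eqxx. Qed.

Lemma sl2_hop_eop i x : hop i (eop i x) = eop i (hop i x) + 2 *: eop i x.
Proof. by rewrite hop_eop a_diag. Qed.

Lemma sl2_hop_fop i x : hop i (fop i x) = fop i (hop i x) - 2 *: fop i x.
Proof. by rewrite hop_fop a_diag. Qed.

(** This is a singular vector: every [e_j] kills it, the coefficient for [j = i] containing the
    factor [c i - c i]. A vector vanishing at the empty word and killed by all [eop] is zero. *)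
Lemma fop_nilp_hwv i : iter (c i).+1 (fop i) hwv = 0.
Proof.
apply/funext => -[//|j l].
have -> : iter (c i).+1 (fop i) hwv (j :: l) = eop j (iter (c i).+1 (fop i) hwv) l by [].
suff -> : eop j (iter (c i).+1 (fop i) hwv) = 0 by [].
have hv : hop i hwv = (c i)%:R *: hwv.
  by rewrite (hop_wvec i [::]) /hwt big_nil subr0 -pmulrn.
have [->|ji] := eqVneq j i.
  rewrite (sl2_E_iterF (sl2_eop_fop i) (sl2_hop_fop i) _ hv) /= eop_hwv iter_lin0 linear0.
  by rewrite subrr mulr0 scale0r addr0.
elim: (c i).+1 => [|k IH]; first exact: eop_hwv.
by rewrite iterS eop_fop eq_sym (negPf ji) addr0 IH linear0.
Qed.

Lemma fop_nilp i w : exists r, iter r (fop i) (wvec w) = 0.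
Proof.
elim: w => [|j w [r IH]]; first by exists (c i).+1; exact: fop_nilp_hwv.
have [<-|ij] := eqVneq i j.
  by exists r; rewrite /= -iterSr iterS IH linear0.
by exists (r + `|a i j|.+1)%N; apply: fop_nilp_step.
Qed.

(** * Monomials with tagged letters, and the deletion of letters *)

Section TaggedWords.
Variable T : Type.
Implicit Types A B w : seq (I * T).

Definition wact A (z : V) : V := foldr (fun p => fop p.1) z A.

Definition tvec w : V := wact w hwv.

Definition wletters w := [seq p.1 | p <- w].

Lemma tvecE w : tvec w = wvec (wletters w).
Proof. by elim: w => //= p w IH; rewrite /tvec /= -/(tvec w) IH. Qed.

Lemma wact_cat A B z : wact (A ++ B) z = wact A (wact B z).
Proof. exact: foldr_cat. Qed.

Lemma wact_nseq n p z : wact (nseq n p) z = iter n (fop p.1) z.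
Proof. by elim: n => //= n ->. Qed.

Lemma wact_linear A : linear (wact A).
Proof. by move=> k x y; elim: A => //= p A ->; rewrite linearP. Qed.

HB.instance Definition _ A := GRing.isLinear.Build rat V V _ (wact A) (wact_linear A).

Lemma submodule_zero_of (f : {linear V -> V}) : submodule_pred (fun x => f x = 0).
Proof. by move=> k x y fx fy; rewrite linearP fx fy scaler0 addr0. Qed.

Lemma hop_tvec i w : hop i (tvec w) = (hwt i (wletters w))%:~R *: tvec w.
Proof. by rewrite tvecE hop_wvec. Qed.

(** [e_i^n] sends a monomial to a combination of monomials with [n] letters [i] removed. The
    survivors keep their order and their tags, which will be times. *)
Inductive del (i : I) : nat -> seq (I * T) -> seq (I * T) -> Prop :=
| del0 B : del i 0 B B
| delS n B1 s B2 B' : del i n (B1 ++ B2) B' -> del i n.+1 (B1 ++ (i, s) :: B2) B'.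

Lemma hwt_del i n B B' : del i n B B' ->
  hwt i (wletters B') = hwt i (wletters B) + n%:Z * 2.
Proof.
elim=> [B1|k B1 s B2 B1' _ ->]; first by rewrite mul0r addr0.
rewrite /hwt /wletters !map_cat !big_cat /= big_cons a_diag.
by have -> : k.+1%:Z = k%:Z + 1 by [lia]; ring.
Qed.

(** Leibniz rule: the commutator is the sum, over the letters [i] of [A], of [A] with this letter
    replaced by [h_i], which acts on weight vectors by a scalar. *)
Lemma eop_wact_commutator (Z : V -> Prop) i A z : submodule_pred Z -> Z 0 ->
  (forall j, exists g : rat, hop j z = g *: z) ->
  (forall A1 s A2, A = A1 ++ (i, s) :: A2 -> Z (wact (A1 ++ A2) z)) ->
  Z (eop i (wact A z) - wact A (eop i z)).
Proof.
move=> HZ Z0 hz; elim: A Z HZ Z0 => [|[j s] A IH] Z HZ Z0 Zdel /=.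
  by rewrite subrr.
have hA : exists g : rat, hop i (wact A z) = g *: wact A z.
  elim: (A) => [|p A' [g IHg]]; first exact: hz.
  exists (g - (a i p.1)%:~R).
  by rewrite /= hop_fop -/(wact A' z) IHg linearZ scalerBl.
rewrite eop_fop addrAC -linearB /=.
apply: (submoduleD HZ); last first.
  case: eqP => // ji; have [g hg] := hA; rewrite ji hg.
  by apply: (submoduleZ _ HZ); apply: (Zdel [::] s); rewrite ji.
apply: (IH (fun x => Z (fop j x))) => [t x y Zx Zy||A1 s' A2 AE].
- by rewrite fop_linear; apply: HZ.
- by rewrite linear0.
- by apply: (Zdel ((j, s) :: A1) s'); rewrite AE.
Qed.

Lemma hop_tvec_wt w j : exists g : rat, hop j (tvec w) = g *: tvec w.
Proof. by exists (hwt j (wletters w))%:~R; exact: hop_tvec. Qed.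

Lemma iter_eop_tvec (Z : V -> Prop) i n w : submodule_pred Z -> Z 0 ->
  (forall w', del i n w w' -> Z (tvec w')) -> Z (iter n (eop i) (tvec w)).
Proof.
elim: n w Z => [|n IH] w Z HZ Z0 Zdel; first by apply: Zdel; exact: del0.
rewrite iterSr -[eop i _]subr0 -(linear0 (wact w)) -(eop_hwv i).
apply: (eop_wact_commutator (Z := fun x => Z (iter n (eop i) x))).
- exact: submodule_pred_iter HZ.
- by rewrite iter_lin0.
- exact: (hop_tvec_wt [::]).
- by move=> A1 s A2 wE; apply: IH => // w' dw'; apply: Zdel; rewrite wE; apply: delS.
Qed.

(** An [e_i] that crosses [A] entirely acts on a vector already known to be zero; the others delete
    letters of [A]. *)
Lemma wact_iter_eop i n A z : (forall j, exists g : rat, hop j z = g *: z) ->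
  (forall k A', (k <= n)%N -> del i k A A' -> wact A' z = 0) ->
  wact A (iter n (eop i) z) = 0.
Proof.
move=> hz.
have wt m j : exists g : rat, hop j (iter m (eop i) z) = g *: iter m (eop i) z.
  elim: m => [|m [g IHg]]; first exact: hz.
  by exists (g + (a j i)%:~R); rewrite iterS hop_eop IHg linearZ scalerDl.
elim: n A => [|n IH] A Zdel; first by apply: (Zdel 0%N) => //; exact: del0.
rewrite iterS.
have ZA : wact A (iter n (eop i) z) = 0.
  by apply: IH => k A' kn; apply: Zdel; exact: leqW.
have := @eop_wact_commutator (fun x => x = 0) i A _ _ erefl (wt n).
rewrite ZA linear0 sub0r => H; apply/eqP; rewrite -oppr_eq0; apply/eqP; apply: H.
  by move=> t x y -> ->; rewrite scaler0 addr0.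
move=> A1 s A2 AE; apply: IH => k A' kn dA.
by apply: (Zdel k.+1) => //; rewrite AE; exact: delS.
Qed.

(** If [n] exceeds the weight, [sl2_lower] replaces [f_i^n] by terms [f_i^(n + k) e_i^k] with
    [k >= n - hwt], and [e_i^k] deletes [k] letters of [B], raising the weight by [2 k]. The kernel
    of [A] is the submodule, so some term survives. *)
Lemma tvec_lower i n A B : wact A (iter n (fop i) (tvec B)) != 0 ->
  exists k B', [/\ del i k B B', wact A (iter (n + k) (fop i) (tvec B')) != 0
                 & (n + k)%:Z <= hwt i (wletters B')].
Proof.
move=> nz; have [nh|hn] := leP n%:Z (hwt i (wletters B)).
  by exists 0%N, B; rewrite addn0; split=> //; exact: del0.
apply: contrapT => nex; move/eqP: nz; apply.
have [r fr] := fop_nilp i (wletters B); rewrite -tvecE in fr.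
apply: (sl2_lower (Z := fun x => wact A x = 0) (sl2_eop_fop i) (sl2_hop_eop i) (sl2_hop_fop i)
  (@submodule_zero_of (wact A)) fr (hop_tvec i B) hn) => k kn.
apply: (iter_eop_tvec (Z := fun x => wact A (iter (n + k) (fop i) x) = 0)).
- exact: (submodule_pred_iter (@submodule_zero_of (wact A))).
- by rewrite iter_lin0 linear0.
move=> B' dB; apply/eqP/negPn/negP => nz; apply: nex; exists k, B'; split=> //.
rewrite (hwt_del dB); lia.
Qed.

(** The dual move: if [n] is below the weight, [sl2_raise] gives terms [e_i^(N - n) f_i^N] with
    [N >= hwt], and the [e_i] delete at most [N - n] letters of [A] on their way out. *)
Lemma tvec_raise i n A B : wact A (iter n (fop i) (tvec B)) != 0 ->
  exists N k A', [/\ (n + k <= N)%N, del i k A A',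
    wact A' (iter N (fop i) (tvec B)) != 0 & hwt i (wletters B) <= N%:Z].
Proof.
move=> nz; have [hn|nh] := leP (hwt i (wletters B)) n%:Z.
  by exists n, 0%N, A; rewrite addn0; split=> //; exact: del0.
have [h hE] : exists h : nat, h%:Z = hwt i (wletters B).
  by exists `|hwt i (wletters B)|%N; lia.
apply: contrapT => nex; move/eqP: nz; apply.
have hB := hop_tvec i B; rewrite -hE -pmulrn in hB.
have := eop_nilp i (wletters B); rewrite -tvecE => er.
apply: (sl2_raise (Z := fun x => wact A x = 0) (sl2_eop_fop i) (sl2_hop_eop i) (sl2_hop_fop i)
  (@submodule_zero_of (wact A)) er hB); first by lia.
move=> N hN.
apply: wact_iter_eop => [j|k A' kN dA].
  elim: N {hN} => [|N [g IHg]]; first exact: hop_tvec_wt.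
  by exists (g - (a j i)%:~R); rewrite iterS hop_fop IHg linearZ scalerBl.
apply/eqP/negPn/negP => nzA; apply: nex; exists N, k, A'; split=> //; lia.
Qed.

End TaggedWords.
End HighestWeightModule.


(** * Running maxima of continuous functions *)
Section UnitInterval.
Variable R : realType.

Definition cont01 (V : normedModType R) (h : R -> V) := forall t, 0 <= t <= 1 ->
  forall e, 0 < e -> exists2 d, 0 < d &
    forall s, 0 <= s <= 1 -> `|s - t| < d -> `|h s - h t| < e.

Lemma cont01P (V : normedModType R) (h : R -> V) :
  {within `[0, 1], continuous h} <-> cont01 h.
Proof.
split.
  move=> /subspace_continuousP hc t t01 e e0.
  have /hc /cvgrPdist_lt /(_ e e0) : `[0, 1]%classic t by rewrite /= in_itv.
  rewrite near_withinE near_nbhs => /nbhs_ballP[d /= d0 dh].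
  exists d => // s s01 std; rewrite distrC; apply: dh; last by rewrite /= in_itv.
  by rewrite /ball /= distrC.
move=> hc; apply/subspace_continuousP => t /=; rewrite in_itv /= => t01.
apply/cvgrPdist_lt => e e0; have [d d0 dh] := hc t t01 e e0.
rewrite near_withinE near_nbhs; apply/nbhs_ballP; exists d => //= s.
by rewrite /ball /= distrC => std; rewrite in_itv /= => s01; rewrite distrC; exact: dh.
Qed.

Lemma cont01_sub (h : R -> R) a b : 0 <= a -> b <= 1 -> cont01 h ->
  {within `[a, b], continuous h}.
Proof.
move=> a0 b1 /cont01P; apply: continuous_subspaceW => t /=.
rewrite /= !in_itv /= => /andP[at' tb].
by rewrite (le_trans a0 at') (le_trans tb b1).
Qed.

Lemma cont01_max (h : R -> R) a b : cont01 h -> 0 <= a -> a <= b -> b <= 1 ->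
  exists2 s, a <= s <= b & forall u, a <= u <= b -> h u <= h s.
Proof.
move=> hc a0 ab b1; have [s] := EVT_max ab (cont01_sub a0 b1 hc).
by rewrite in_itv /= => sab smax; exists s => // u uab; apply: smax.
Qed.

Lemma cont01_rev (V : normedModType R) (h : R -> V) :
  cont01 h -> cont01 (fun t => h (1 - t)).
Proof.
move=> hc t t01 e e0; have [|d d0 dh] := hc (1 - t) _ e e0; first by lra.
exists d => // s s01 std; apply: dh; first by lra.
have -> : 1 - s - (1 - t) = - (s - t) by ring.
by rewrite normrN.
Qed.

Lemma cont01N (h : R -> R) : cont01 h -> cont01 (fun t => - h t).
Proof.
move=> hc t t01 e e0; have [d d0 dh] := hc t t01 e e0.
by exists d => // s s01 /(dh s s01); rewrite -normrN opprB opprK addrC.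
Qed.

Lemma cont01D (h k : R -> R) : cont01 h -> cont01 k -> cont01 (fun t => h t + k t).
Proof.
move=> hc kc t t01 e e0; have e2 : 0 < e / 2 by lra.
have [d1 d10 dh1] := hc t t01 _ e2; have [d2 d20 dh2] := kc t t01 _ e2.
exists (Num.min d1 d2); first by rewrite lt_min d10.
move=> s s01; rewrite lt_min => /andP[/(dh1 s s01) H1 /(dh2 s s01) H2].
have -> : h s + k s - (h t + k t) = (h s - h t) + (k s - k t) by ring.
by apply: le_lt_trans (ler_normD _ _) _; lra.
Qed.

Lemma cont01_lip (V W : normedModType R) (h : R -> V) (k : R -> W) C : cont01 h ->
  (forall s t, 0 <= s <= 1 -> 0 <= t <= 1 -> `|k s - k t| <= C * `|h s - h t|) ->
  cont01 k.
Proof.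
move=> hc hk t t01 e e0; have C0 : 0 < `|C| + 1 by rewrite ltr_wpDl.
have [d d0 dh] := hc t t01 (e / (`|C| + 1)) (divr_gt0 e0 C0).
exists d => // s s01 /(dh s s01) H; apply: le_lt_trans (hk s t s01 t01) _.
apply: (@le_lt_trans _ _ ((`|C| + 1) * `|h s - h t|)).
  by apply: ler_wpM2r => //; have := ler_norm C; lra.
by rewrite mulrC -ltr_pdivlMr.
Qed.

Lemma last_below (h : R -> R) a b l : cont01 h -> 0 <= a -> a <= b -> b <= 1 ->
  h a <= l -> exists s, [/\ a <= s <= b, h s <= l,
    (forall u, s < u <= b -> l < h u) & (l <= h b -> h s = l)].
Proof.
move=> hc a0 ab b1 hal.
pose S := [set s | a <= s <= b /\ h s <= l].
have Sa : S a by rewrite /S /= lexx ab.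
have ubS : ubound S b by move=> s [/andP[]].
have supS : has_sup S by split; [exists a|exists b].
have aS : a <= sup S by apply: ub_le_sup => //; exists b.
have Sb : sup S <= b by apply: ge_sup => //; exists a.
have S01 : 0 <= sup S <= 1 by rewrite (le_trans a0 aS) (le_trans Sb b1).
have hs : h (sup S) <= l.
  rewrite leNgt; apply/negP => lh.
  have [|d d0 dh] := hc _ S01 (h (sup S) - l); first by rewrite subr_gt0.
  have [s [/andP[as' sb] hsl] sS] := sup_adherent d0 supS.
  have s_le : s <= sup S by apply: ub_le_sup; [exists b|split; rewrite ?as'].
  have := dh s; have -> : 0 <= s <= 1 by lra.
  move=> /(_ isT); rewrite distrC ger0_norm; last by lra.
  have /[swap]/[apply] : sup S - s < d by lra.
  by rewrite distrC ger0_norm; lra.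
have after u : sup S < u <= b -> l < h u.
  move=> /andP[Su ub]; rewrite ltNge; apply/negP => hul.
  suff : u <= sup S by lra.
  by apply: ub_le_sup; [exists b|split => //; apply/andP; split => //; lra].
exists (sup S); split=> // [|lb]; first by rewrite aS.
apply/eqP; rewrite eq_le hs /= leNgt; apply/negP => hl.
have [E|Sltb] := eqVneq (sup S) b; first by rewrite E in hl; lra.
have {}Sltb : sup S < b by rewrite lt_neqAle Sltb.
have [|d d0 dh] := hc _ S01 (l - h (sup S)); first by lra.
pose u := sup S + Num.min (d / 2) (b - sup S).
have mpos : 0 < Num.min (d / 2) (b - sup S) by rewrite lt_min; lra.
have m1 : Num.min (d / 2) (b - sup S) <= d / 2 by rewrite ge_min lexx.
have m2 : Num.min (d / 2) (b - sup S) <= b - sup S by rewrite ge_min lexx orbT.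
have lu : l < h u by apply: after; rewrite /u; lra.
have := dh u; have -> : 0 <= u <= 1 by rewrite /u; lra.
move=> /(_ isT); rewrite (_ : u - _ = Num.min (d / 2) (b - sup S)); last by rewrite /u; ring.
rewrite gtr0_norm // => /(_ _)/lt_le_trans => H.
have := ler_norm (h u - h (sup S)); have : Num.min (d / 2) (b - sup S) < d by lra.
by move=> /H/(_ (lexx _)); lra.
Qed.

Lemma first_below (h : R -> R) a b l : cont01 h -> 0 <= a -> a <= b -> b <= 1 ->
  h b <= l -> exists s, [/\ a <= s <= b, h s <= l,
    (forall u, a <= u < s -> l < h u) & (l <= h a -> h s = l)].
Proof.
move=> hc a0 ab b1 hbl.
have [||||s [sab hs after eq]] := @last_below (fun t => h (1 - t)) (1 - b) (1 - a) l (cont01_rev hc).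
- by lra.
- by lra.
- by lra.
- by rewrite (_ : 1 - (1 - b) = b) //; ring.
exists (1 - s); split=> //; first by lra.
  move=> u us; have := after (1 - u); rewrite (_ : 1 - (1 - u) = u); last by ring.
  by apply; lra.
by rewrite (_ : 1 - (1 - a) = a) in eq; last by ring.
Qed.

(** Minus the running minimum. With this sign it grows from 0 when [h 0 = 0], and its value at 1 is
    minus the minimum used by the root operators. *)
Definition rmax (h : R -> R) (t : R) : R := sup [set - h s | s in `[0, t]%classic].

Section RunningMax.
Variable h : R -> R.
Hypothesis hc : cont01 h.
Local Notation K := (rmax h).

Lemma rmax_ex t : 0 <= t <= 1 -> exists2 s, 0 <= s <= t & K t = - h s.
Proof.
move=> /andP[t0 t1]; have [s st smax] := cont01_max (cont01N hc) (lexx 0) t0 t1.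
exists s => //; apply/eqP; rewrite eq_le; apply/andP; split.
  apply: ge_sup; first by exists (- h s), s => //=; rewrite in_itv.
  by move=> y [u /=]; rewrite in_itv /= => ut <-; exact: smax.
apply: ub_le_sup; last by exists s => //=; rewrite in_itv.
by exists (- h s) => y [u /=]; rewrite in_itv /= => ut <-; exact: smax.
Qed.

Lemma rmax_ge s t : 0 <= s -> s <= t -> t <= 1 -> - h s <= K t.
Proof.
move=> s0 st t1; have t0 := le_trans s0 st.
have [u ut umax] := cont01_max (cont01N hc) (lexx 0) t0 t1.
apply: ub_le_sup; last by exists s => //=; rewrite in_itv /= s0.
by exists (- h u) => y [v /=]; rewrite in_itv /= => vt <-; exact: umax.
Qed.

Lemma rmax_mono s t : 0 <= s -> s <= t -> t <= 1 -> K s <= K t.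
Proof.
move=> s0 st t1; have [|u us ->] := @rmax_ex s; first by lra.
by apply: rmax_ge => //; lra.
Qed.

Lemma rmax0 : K 0 = - h 0.
Proof.
have [|s s0 ->] := @rmax_ex 0; first by lra.
by have -> : s = 0 by lra.
Qed.

Lemma rmax_cont : cont01 K.
Proof.
have step s t e : 0 < e -> 0 <= s -> s <= t -> t <= 1 ->
    (forall u, s <= u <= t -> `|h u - h s| < e) -> `|K t - K s| < e.
  move=> e0 s0 st t1 H; have Kst := rmax_mono s0 st t1.
  rewrite ger0_norm ?subr_ge0 //.
  have [|u ut ->] := @rmax_ex t; first by lra.
  have [us|su] := leP u s.
    have u0 : 0 <= u by lra.
    by have := rmax_ge u0 us; have -> : s <= 1 by [lra]; move=> /(_ isT); lra.
  have := H u; have -> : s <= u <= t by lra.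
  move=> /(_ isT); have := rmax_ge s0 (lexx s) (le_trans st t1).
  by rewrite ltr_norml; lra.
move=> t t01 e e0; have e2 : 0 < e / 2 by lra.
have [d d0 dh] := hc t01 e2; exists d => // s s01 std.
have near u : 0 <= u <= 1 -> `|u - t| <= `|s - t| -> `|h u - h t| < e / 2.
  by move=> u01 ut; apply: dh => //; exact: le_lt_trans std.
have [st|ts] := leP s t.
  rewrite distrC; apply: step => // [||u ust]; [by lra|by lra|].
  have -> : h u - h s = (h u - h t) - (h s - h t) by ring.
  have H1 := near s s01 (lexx _).
  have /near H2 : 0 <= u <= 1 by lra.
  have {}H2 : `|h u - h t| < e / 2.
    by apply: H2; rewrite !ler0_norm; lra.
  by apply: le_lt_trans (ler_normB _ _) _; lra.
apply: step => // [|||u ust]; [by lra|by lra|by lra|].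
apply: (@lt_trans _ _ (e / 2)); last by lra.
by apply: near; [lra|rewrite !ger0_norm; lra].
Qed.

Lemma rmax_first th : 0 <= th -> th <= K 1 -> - h 0 <= th ->
  exists tau, [/\ 0 <= tau <= 1, h tau = - th, K tau = th
    & forall u, 0 <= u < tau -> K u < th].
Proof.
move=> th0 thK h0; have [|s s1 Ks] := @rmax_ex 1; first by lra.
have [||||tau [tau01 _ before eq]] := @first_below h 0 s (- th) hc; rewrite ?lexx //; try lra.
have htau : h tau = - th by apply: eq; lra.
have Ku u : 0 <= u < tau -> K u < th.
  move=> ut; have [|v vu ->] := @rmax_ex u; first by lra.
  by have := before v; have -> : 0 <= v < tau by [lra]; move=> /(_ isT); lra.
exists tau; split=> //; first by lra.
have [|v vt Kt] := @rmax_ex tau; first by lra.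
have : th <= K tau by rewrite -[th]opprK -htau; apply: rmax_ge; lra.
have [vtau|vtau] := ltP v tau; last by have E : v = tau by [lra]; rewrite Kt E; lra.
have : - h v <= K v by apply: rmax_ge; lra.
by have := Ku v; have -> : 0 <= v < tau by [lra]; move=> /(_ isT); lra.
Qed.

(** [K] grows right after its last time at level [th]; if [h] were above [- th] at that time, it
    would stay above for a while and [K] would stay constant. *)
Lemma rmax_last th : th < K 1 -> - h 0 <= th ->
  exists sg, [/\ 0 <= sg <= 1, h sg = - th, K sg = th
    & forall u, sg < u <= 1 -> th < K u].
Proof.
move=> thK h0.
have [||||sg [sg01 _ after eq]] := @last_below K 0 1 th rmax_cont; rewrite ?lexx ?ler01 ?rmax0 //.
have Ksg : K sg = th by apply: eq; lra.
exists sg; split=> //.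
have hsg : - h sg <= th by rewrite -Ksg; apply: rmax_ge; lra.
apply/eqP; rewrite eq_le; apply/andP; split; last by lra.
rewrite leNgt; apply/negP => hl.
have [||d d0 dh] := hc (t := sg) _ (e := h sg + th); [by lra|by lra|].
have sg1 : sg < 1.
  by rewrite lt_neqAle; have [E|_] := eqVneq sg 1; [rewrite -Ksg E in thK; lra|lra].
pose m := Num.min (d / 2) (1 - sg).
have mpos : 0 < m by rewrite lt_min; lra.
have m1 : m <= d / 2 by rewrite ge_min lexx.
have m2 : m <= 1 - sg by rewrite ge_min lexx orbT.
have := after (sg + m); have -> : sg < sg + m <= 1 by lra.
move=> /(_ isT); have [|v vm ->] := @rmax_ex (sg + m); first by lra.
have [vs|sv] := leP v sg.
  by have : - h v <= K sg by [apply: rmax_ge; lra]; lra.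
have := dh v; have -> : 0 <= v <= 1 by lra.
move=> /(_ isT); rewrite gtr0_norm; last by lra.
have /[swap]/[apply] : v - sg < d by lra.
by rewrite ltr_norml; lra.
Qed.

End RunningMax.
End UnitInterval.


(** * Monomials weighted by a path *)
Section Reach.
Variables (R : realType) (I : eqType) (a : I -> I -> int) (c : I -> nat).
Hypothesis a_diag : forall i, a i i = 2.
Hypothesis a_offdiag : forall i j, i != j -> a i j <= 0.
Hypothesis a_zero : forall i j, a i j = 0 -> a j i = 0.
Implicit Types (w A B : seq (I * R)) (H : I -> R -> R) (p : I * R).

Local Notation tvec := (tvec a c).
Local Notation wact := (wact a c).
Local Notation hwt := (hwt a c).
Local Notation fop := (fop a c).

(* The head of a word acts last, at the earliest time. *)
Definition earlier (p q : I * R) := p.2 <= q.2.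

Definition timed w := pairwise earlier w && all (fun p => 0 <= p.2 <= 1) w.

Definition cost H w : R := \sum_(p <- w) H p.1 p.2.

(** An up-closed set whose infimum is the invariant; comparing these sets avoids asking whether the
    infimum is finite or attained. *)
Definition reach H (z : R) :=
  exists w, [/\ timed w, tvec w != 0 & cost H w <= z].

Lemma cost_cat H w1 w2 : cost H (w1 ++ w2) = cost H w1 + cost H w2.
Proof. exact: big_cat. Qed.

Lemma cost_cons H p w : cost H (p :: w) = H p.1 p.2 + cost H w.
Proof. exact: big_cons. Qed.

Lemma cost_nseq H n p : cost H (nseq n p) = n%:R * H p.1 p.2.
Proof. by rewrite /cost big_nseq iter_addr addr0 mulr_natl. Qed.

Lemma cost_ge H w l : all (fun p => l <= H p.1 p.2) w -> (size w)%:R * l <= cost H w.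
Proof.
elim: w => [|p w IH] /=; first by rewrite mul0r /cost big_nil.
move=> /andP[lp /IH]; rewrite /cost big_cons -natr1; lra.
Qed.

Lemma eq_cost H H' w : (forall p, p \in w -> H p.1 p.2 = H' p.1 p.2) ->
  cost H w = cost H' w.
Proof. by move=> E; apply: eq_big_seq. Qed.

Lemma reach_nil H : reach H 0.
Proof.
exists [::]; split=> //; last by rewrite /cost big_nil.
by apply/eqP => /(congr1 (fun x => x [::])).
Qed.

Lemma reach_ge0 H z : (forall i t, 0 <= t <= 1 -> 0 <= H i t) -> reach H z -> 0 <= z.
Proof.
move=> H0 [w [/andP[_ /allP w01] _]]; apply: le_trans; rewrite /cost big_seq.
by apply: sumr_ge0 => p /w01; exact: H0.
Qed.

Lemma reach_ext H H' z : (forall i t, 0 <= t <= 1 -> H i t = H' i t) ->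
  reach H z -> reach H' z.
Proof.
move=> E [w [tw nz cz]]; exists w; split=> //; rewrite -(eq_cost (H := H)) // => p pw.
by apply: E; have /andP[_ /allP] := tw; apply.
Qed.

Lemma tvec_map_time (g : R -> R) w :
  tvec [seq (p.1, g p.2) | p <- w] = tvec w.
Proof. by rewrite !tvecE /wletters -map_comp. Qed.

Lemma reach_reparam H H' (g : R -> R) z :
  (forall s t, 0 <= s <= 1 -> 0 <= t <= 1 -> s <= t -> g s <= g t) ->
  (forall t, 0 <= t <= 1 -> 0 <= g t <= 1) ->
  (forall i t, 0 <= t <= 1 -> H i t = H' i (g t)) ->
  reach H z -> reach H' z.
Proof.
move=> gm g01 E [w [/andP[pw w01] nz cz]].
exists [seq (p.1, g p.2) | p <- w]; split; last 2 first.
- by rewrite tvec_map_time.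
- rewrite /cost big_map /= -/(cost (fun i t => H' i (g t)) w).
  rewrite -(eq_cost (H := H)) // => p pw'.
  by apply: E; move/allP: w01; apply.
apply/andP; split; last first.
  by rewrite all_map; apply: sub_all w01 => p /=; exact: g01.
elim: w pw w01 {nz cz} => //= p w IH /andP[pw ppw] /andP[p01 w01].
rewrite IH // andbT all_map; apply/allP => q qw /=.
by move/allP: w01 => /(_ q qw) q01; apply: gm => //; move/allP: pw; apply.
Qed.

Lemma timed_cat w1 w2 : timed (w1 ++ w2) =
  [&& timed w1, timed w2 & allrel earlier w1 w2].
Proof.
rewrite /timed pairwise_cat all_cat; by case: (allrel _ _ _); case: (pairwise _ _);
  case: (pairwise _ _); case: (all _ _); case: (all _ _).
Qed.

Lemma timed_nseq n i t : 0 <= t <= 1 -> timed (nseq n (i, t)).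
Proof.
move=> t01; apply/andP; split; last by rewrite all_nseq t01 orbT.
by elim: n => //= n ->; rewrite all_nseq /earlier lexx orbT.
Qed.

Lemma allrel_earlier t w1 w2 : all (fun p => p.2 <= t) w1 ->
  all (fun p => t <= p.2) w2 -> allrel earlier w1 w2.
Proof.
move=> /allP w1t /allP w2t; apply/allrelP => p q /w1t pt /w2t tq.
exact: le_trans pt tq.
Qed.

Lemma timed_split (P : pred (I * R)) w :
  (forall p q, earlier p q -> P q -> P p) -> timed w ->
  w = [seq p <- w | P p] ++ [seq p <- w | ~~ P p].
Proof.
move=> HP /andP[+ _]; elim: w => //= p w IH /andP[pw /IH E].
case: ifP => Pp; first by rewrite /= -E.
have : ~~ has P w.
  by apply/hasPn => q qw; apply/negP => /(HP p q (allP pw q qw)); rewrite Pp.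
by rewrite has_filter negbK => /eqP fw; rewrite [in LHS]E fw.
Qed.

Lemma del_all (P : pred (I * R)) i k B B' : del i k B B' -> all P B -> all P B'.
Proof.
elim=> // n B1 s B2 B'' _ IH; rewrite all_cat /= => /and3P[p1 _ p2].
by apply: IH; rewrite all_cat p1.
Qed.

Lemma del_timed i k B B' : del i k B B' -> timed B -> timed B'.
Proof.
move=> dB /andP[pB aB]; apply/andP; split; last exact: del_all dB aB.
elim: dB pB {aB} => // n B1 s B2 B'' _ IH; rewrite pairwise_cat /= allrel_consr.
move=> /and4P[/andP[_ r12] p1 _ p2].
by apply: IH; rewrite pairwise_cat r12 p1.
Qed.

Lemma del_cost H i k l B B' : del i k B B' ->
  all (fun p => (p.1 == i) ==> (- l <= H p.1 p.2)) B ->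
  cost H B' <= cost H B + k%:R * l.
Proof.
elim=> [B1|n B1 s B2 B'' _ IH]; first by rewrite mul0r addr0.
rewrite all_cat /= eqxx => /and3P[a1 ls a2].
have /IH : all (fun p => (p.1 == i) ==> (- l <= H p.1 p.2)) (B1 ++ B2).
  by rewrite all_cat a1.
rewrite !cost_cat cost_cons -natr1 /=; lra.
Qed.

(** * Partial raising operators and the cost of words *)

Section Shift.
Variables (H : I -> R -> R) (al : I).
Hypothesis Hc : cont01 (H al).
Hypothesis H0 : H al 0 = 0.
Local Notation K := (rmax (H al)).

(* The heights of [q + max(0, K - th) alpha], which interpolates between [q]
   at [th = K 1] and [e_alpha q] at [th = K 1 - 1]. *)
Definition Hshift (th : R) : I -> R -> R :=
  fun j t => H j t + (a al j)%:~R * Num.max 0 (K t - th).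

Lemma Hshift_below th t j : K t <= th -> Hshift th j t = H j t.
Proof. by move=> Kt; rewrite /Hshift max_l ?mulr0 ?addr0 //; lra. Qed.

Lemma Hshift_above th th' t j : th' <= th -> th <= K t ->
  Hshift th' j t = Hshift th j t + (a al j)%:~R * (th - th').
Proof. by move=> tt thK; rewrite /Hshift !max_r; [ring|lra|lra]. Qed.

Lemma Hshift_ge th t : 0 <= t <= 1 -> - th <= Hshift th al t.
Proof.
move=> t01; have t0 : 0 <= t by lra. have t1 : t <= 1 by lra.
have := rmax_ge Hc t0 (lexx t) t1; rewrite /Hshift a_diag.
by have [Kt|Kt] := leP 0 (K t - th); lra.
Qed.

(** The letters other than [al] keep their times, taken in a finite list, so only finitely many
    values of [K] must be avoided while the threshold moves. *)
Definition reach_at (ts : seq R) (h : I -> R -> R) (z : R) :=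
  exists w, [/\ timed w, tvec w != 0, cost h w <= z
    & all (fun p => (p.1 == al) || (p.2 \in ts)) w].

(** The Cartan integers of the letters of [B] add up to [c al] minus the weight of the vector they
    produce. This [c al] is the origin of the final gain. *)
Lemma cost_shift th th' B : th' <= th -> all (fun p => th <= K p.2) B ->
  cost (Hshift th') B = cost (Hshift th) B +
    ((c al)%:~R - (hwt al (wletters B))%:~R) * (th - th').
Proof.
move=> tt /allP KB; rewrite /hwt.
have -> : ((c al)%:Z - \sum_(j <- wletters B) a al j)%:~R =
    (c al)%:~R - \sum_(p <- B) (a al p.1)%:~R :> R.
  by rewrite rmorphB /= /wletters big_map rmorph_sum.
rewrite opprB addrCA subrr addr0 mulr_suml -big_split /=.
by apply: eq_big_seq => p /KB pK; rewrite (Hshift_above _ tt pK).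
Qed.

Lemma wact_al w : all (fun p => p.1 == al) w ->
  forall z, wact w z = iter (size w) (fop al) z.
Proof. by elim: w => //= p w IH /andP[/eqP-> aw] z; rewrite IH. Qed.

(* If no letter other than [al] sits where [th' < K < th], then only the
   letters [al] between the last time [K = th'] and the first time [K = th] have
   to be moved. *)
Section Step.
Variables (ts : seq R) (th th' : R).
Hypothesis th'0 : 0 <= th'.
Hypothesis thth : th' < th.
Hypothesis thK : th <= K 1.
Hypothesis tsK : forall t, t \in ts -> 0 <= t <= 1 -> K t <= th' \/ th <= K t.

Let window : exists sg tau, [/\ 0 <= sg <= 1, 0 <= tau <= 1, sg < tau,
  [/\ K sg = th', K tau = th, H al sg = - th' & H al tau = - th] &
  (forall u, sg < u <= 1 -> th' < K u) /\ (forall u, 0 <= u < tau -> K u < th)].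
Proof.
have t0 := th'0; have t1 := thth; have t2 := thK.
have [||sg [sg01 hsg Ksg after]] := rmax_last Hc (th := th'); rewrite ?H0; try lra.
have [|||tau [tau01 htau Ktau before]] := rmax_first Hc (th := th); rewrite ?H0; try lra.
exists sg, tau; split=> //; rewrite ltNge; apply/negP => ts'.
by have := rmax_mono Hc (s := tau) (t := sg); rewrite Ksg Ktau; lra.
Qed.

Let split3 sg tau w : 0 <= sg -> sg < tau -> tau <= 1 ->
  (forall u, sg < u <= 1 -> th' < K u) -> (forall u, 0 <= u < tau -> K u < th) ->
  timed w -> all (fun p => (p.1 == al) || (p.2 \in ts)) w ->
  exists A M B, [/\ w = A ++ M ++ B, all (fun p => p.2 <= sg) A,
    all (fun p => tau <= p.2) B &
    all (fun p => p.1 == al) M].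
Proof.
move=> sg0 st tau1 after before tw aw.
have E1 := @timed_split (fun p => p.2 <= sg) w (fun p q pq qs => le_trans pq qs) tw.
set A := [seq p <- w | _] in E1; set w' := [seq p <- w | _] in E1.
have tw' : timed w' by move: tw; rewrite [in timed w]E1 timed_cat => /and3P[].
have E2 := @timed_split (fun p => p.2 < tau) w' (fun p q pq qs => le_lt_trans pq qs) tw'.
set M := [seq p <- w' | _] in E2; set B := [seq p <- w' | _] in E2.
exists A, M, B; split; [by rewrite -E2|exact: filter_all| |].
  by apply/allP => p; rewrite mem_filter -leNgt => /andP[].
have inw p : p \in M -> [/\ sg < p.2, p.2 < tau & p \in w].
  by rewrite !mem_filter -ltNge => /and3P[].
(* Strictly between [sg] and [tau], [K] lies strictly between [th'] and [th], which excludes the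
   times of [ts]. *)
apply/allP => p /inw[p1 p2 pw]; have := allP aw p pw; case: eqP => //= _ pts.
have p01 : 0 <= p.2 <= 1 by have /andP[_ /allP] := tw; apply.
have := after p.2; have := before p.2; have := tsK pts p01.
by move=> [] H1 H2 H3; have := H3; have := H2; lra.
Qed.

(** The letters of [M], and as many as [tvec_lower] takes out of [B], are put at [sg], at height
    [- th'] instead of at least [- th]. The extra cost is at most [(size M + k) (th - th')], which
    the weight of [B'] in [cost_shift] compensates. *)
Lemma reach_step_down z : reach_at ts (Hshift th) z ->
  reach_at ts (Hshift th') (z + (c al)%:R * (th - th')).
Proof.
have t0 := th'0; have t1 := thth; have t2 := thK.
move=> [w [tw nz cz aw]].
have [sg [tau [sg01 tau01 st [Ksg Ktau hsg htau] [after before]]]] := window.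
have [[sg0 sg1] [tau0 tau1]] := (andP sg01, andP tau01).
have [A [M [B [wE Asg Btau Mal]]]] := split3 sg0 st tau1 after before tw aw.
move: nz; rewrite wE /tvec !wact_cat (wact_al Mal) => nz.
have [k [B' [dB nz' hB']]] := tvec_lower a_diag a_offdiag a_zero nz.
move: tw aw cz; rewrite wE !timed_cat !all_cat !cost_cat.
move=> /and3P[tA /and3P[tM tB rMB] rA] /and3P[aA aM aB] cz.
have B01 : all (fun p => 0 <= p.2 <= 1) B by case/andP: tB.
have A01 : all (fun p => 0 <= p.2 <= 1) A by case/andP: tA.
have M01 : all (fun p => 0 <= p.2 <= 1) M by case/andP: tM.
exists (A ++ nseq (size M + k) (al, sg) ++ B'); split.
- rewrite !timed_cat tA timed_nseq // (del_timed dB tB) /=.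
  have B's : all (fun p => sg <= p.2) B'.
    by apply: del_all dB _; apply: sub_all Btau => p /=; lra.
  rewrite (@allrel_earlier sg) ?all_nseq /= ?lexx ?orbT //=.
  rewrite (@allrel_earlier sg) // all_cat all_nseq /= lexx orbT /=.
  exact: B's.
- by rewrite /tvec !wact_cat wact_nseq.
- rewrite !cost_cat cost_nseq /=.
  have -> : cost (Hshift th') A = cost (Hshift th) A.
    apply: eq_cost => p pA; have /= psg := allP Asg p pA; have /= p01 := allP A01 p pA.
    have : K p.2 <= th' by rewrite -Ksg; apply: (rmax_mono Hc); lra.
    by move=> Kp; rewrite !Hshift_below //; lra.
  have BK : all (fun p => th <= K p.2) B'.
    apply: del_all dB _; apply/allP => p pB; rewrite -Ktau.
    have /= ptau := allP Btau p pB; have /= p01 := allP B01 p pB.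
    by apply: (rmax_mono Hc); lra.
  rewrite (cost_shift (ltW thth) BK) Hshift_below ?Ksg // hsg.
  have c1 : cost (Hshift th) B' <= cost (Hshift th) B + k%:R * th.
    apply: del_cost dB _; apply/allP => p pB; apply/implyP => /eqP ->.
    by apply: Hshift_ge; exact: (allP B01).
  have c2 : (size M)%:R * - th <= cost (Hshift th) M.
    apply: cost_ge; apply/allP => p pM; rewrite (eqP (allP Mal p pM)).
    by apply: Hshift_ge; exact: (allP M01).
  rewrite natrD.
  have : ((size M + k)%N%:Z)%:~R <= (hwt al (wletters B'))%:~R :> R by rewrite ler_int.
  rewrite -pmulrn natrD => hB'R.
  have : (size M)%:R * (th - th') + k%:R * (th - th') <=
      (hwt al (wletters B'))%:~R * (th - th').
    by rewrite -mulrDl; apply: ler_wpM2r => //; lra.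
  rewrite -pmulrn; lra.
- by rewrite !all_cat aA (del_all dB aB) andbT all_nseq /= eqxx orbT.
Qed.

(** Here [k] letters leave [A] and [N] letters sit at [tau], at height [- th]. The loss on [A] and
    [M] is covered by [size M + k <= N] and [th' >= 0], the shift of [B] by its weight being at most
    [N]. *)
Lemma reach_step_up z : reach_at ts (Hshift th') z ->
  reach_at ts (Hshift th) (z - (c al)%:R * (th - th')).
Proof.
have t0 := th'0; have t1 := thth; have t2 := thK.
move=> [w [tw nz cz aw]].
have [sg [tau [sg01 tau01 st [Ksg Ktau hsg htau] [after before]]]] := window.
have [[sg0 sg1] [tau0 tau1]] := (andP sg01, andP tau01).
have [A [M [B [wE Asg Btau Mal]]]] := split3 sg0 st tau1 after before tw aw.
move: nz; rewrite wE /tvec !wact_cat (wact_al Mal) => nz.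
have [N [k [A' [Nk dA nz' hB]]]] := tvec_raise a_diag nz.
move: tw aw cz; rewrite wE !timed_cat !all_cat !cost_cat.
move=> /and3P[tA /and3P[tM tB rMB] rA] /and3P[aA aM aB] cz.
have B01 : all (fun p => 0 <= p.2 <= 1) B by case/andP: tB.
have A01 : all (fun p => 0 <= p.2 <= 1) A by case/andP: tA.
have M01 : all (fun p => 0 <= p.2 <= 1) M by case/andP: tM.
exists (A' ++ nseq N (al, tau) ++ B); split.
- rewrite !timed_cat (del_timed dA tA) timed_nseq // tB /=.
  have A's : all (fun p => p.2 <= tau) A'.
    by apply: del_all dA _; apply: sub_all Asg => p /=; lra.
  rewrite (@allrel_earlier tau) ?all_nseq /= ?lexx ?orbT //=.
  by rewrite (@allrel_earlier tau) // all_cat all_nseq /= lexx orbT /=.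
- by rewrite /tvec !wact_cat wact_nseq.
- rewrite !cost_cat cost_nseq /=.
  have AK p : p \in A -> K p.2 <= th'.
    move=> pA; have /= psg := allP Asg p pA; have /= p01 := allP A01 p pA.
    by rewrite -Ksg; apply: (rmax_mono Hc); lra.
  have EA : cost (Hshift th) A' = cost (Hshift th') A'.
    have : all (fun p => K p.2 <= th') A' by apply: del_all dA _; apply/allP => p /AK.
    by move=> /allP A'K; apply: eq_cost => p /A'K Kp; rewrite !Hshift_below //; lra.
  have BK : all (fun p => th <= K p.2) B.
    apply/allP => p pB; rewrite -Ktau.
    have /= ptau := allP Btau p pB; have /= p01 := allP B01 p pB.
    by apply: (rmax_mono Hc); lra.
  have EB := cost_shift (ltW thth) BK.
  have c1 : cost (Hshift th') A' <= cost (Hshift th') A + k%:R * th'.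
    apply: del_cost dA _; apply/allP => p pA; apply/implyP => /eqP ->.
    by apply: Hshift_ge; exact: (allP A01).
  have c2 : (size M)%:R * - th' <= cost (Hshift th') M.
    apply: cost_ge; apply/allP => p pM; rewrite (eqP (allP Mal p pM)).
    by apply: Hshift_ge; exact: (allP M01).
  rewrite EA Hshift_below ?Ktau // htau.
  have hBR : (hwt al (wletters B))%:~R <= N%:R :> R by rewrite pmulrn ler_int.
  have hx : (hwt al (wletters B))%:~R * (th - th') <= N%:R * (th - th').
    by apply: ler_wpM2r => //; lra.
  have Nx : ((size M)%:R + k%:R) * th' <= N%:R * th'.
    by apply: ler_wpM2r => //; rewrite -natrD ler_nat.
  by rewrite -pmulrn in EB; lra.
- by rewrite !all_cat aB (del_all dA aA) andbT all_nseq /= eqxx orbT.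
Qed.

End Step.
End Shift.
End Reach.

(** * Shifts across finitely many levels *)

Section ReachShift.
Variables (R : realType) (I : eqType) (a : I -> I -> int) (c : I -> nat).
Hypothesis a_diag : forall i, a i i = 2.
Hypothesis a_offdiag : forall i j, i != j -> a i j <= 0.
Hypothesis a_zero : forall i j, a i j = 0 -> a j i = 0.

Lemma chain_avoiding (levels : seq R) (rel : R -> R -> Prop) lo hi :
  (forall x y z, rel x y -> rel y z -> rel x z) ->
  (forall x y, lo <= x -> x < y -> y <= hi ->
     (forall t, t \in levels -> t <= x \/ y <= t) -> rel x y) ->
  lo < hi -> rel lo hi.
Proof.
move=> trans; elim: levels lo hi => [|t ts IH] lo hi step lohi.
  by apply: step => // t; rewrite in_nil.
have [tlo|lot] := leP t lo.
  apply: IH => // x y lx xy yh avoid; apply: step => // u.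
  rewrite inE => /predU1P[->|]; last exact: avoid.
  by left; exact: le_trans tlo lx.
have [hit|thi] := leP hi t.
  apply: IH => // x y lx xy yh avoid; apply: step => // u.
  rewrite inE => /predU1P[->|]; last exact: avoid.
  by right; exact: le_trans yh hit.
apply: (trans _ t); apply: IH => // x y lx xy yh avoid; apply: step => //.
- exact: le_trans yh (ltW thi).
- by move=> u; rewrite inE => /predU1P[->|]; [right|exact: avoid].
- exact: le_trans (ltW lot) lx.
- by move=> u; rewrite inE => /predU1P[->|]; [left|exact: avoid].
Qed.

Variables (H : I -> R -> R) (al : I).
Hypothesis Hc : cont01 (H al).
Hypothesis H0 : H al 0 = 0.
Local Notation K := (rmax (H al)).

Lemma reach_at_shift ts lo hi : 0 <= lo -> lo < hi -> hi <= K 1 -> forall z,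
  (reach_at a c al ts (Hshift a H al hi) z ->
   reach_at a c al ts (Hshift a H al lo) (z + (c al)%:R * (hi - lo))) /\
  (reach_at a c al ts (Hshift a H al lo) z ->
   reach_at a c al ts (Hshift a H al hi) (z - (c al)%:R * (hi - lo))).
Proof.
move=> lo0 lohi hiK.
pose rel x y := forall z,
  (reach_at a c al ts (Hshift a H al y) z ->
   reach_at a c al ts (Hshift a H al x) (z + (c al)%:R * (y - x))) /\
  (reach_at a c al ts (Hshift a H al x) z ->
   reach_at a c al ts (Hshift a H al y) (z - (c al)%:R * (y - x))).
apply: (@chain_avoiding [seq K t | t <- ts & 0 <= t <= 1] rel) => // [x y w xy yw z|x y lx xy yh avoid z].
  split=> rz.
    have -> : z + (c al)%:R * (w - x) = z + (c al)%:R * (w - y) + (c al)%:R * (y - x).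
      by ring.
    exact: (xy _).1 ((yw z).1 rz).
  have -> : z - (c al)%:R * (w - x) = z - (c al)%:R * (y - x) - (c al)%:R * (w - y).
    by ring.
  exact: (yw _).2 ((xy z).2 rz).
have x0 := le_trans lo0 lx; have yK := le_trans yh hiK.
have tsK t : t \in ts -> 0 <= t <= 1 -> K t <= x \/ y <= K t.
  by move=> tts t01; apply: avoid; apply/mapP; exists t; rewrite ?mem_filter ?t01.
by split; [exact: reach_step_down|exact: reach_step_up].
Qed.

Lemma reach_reach_at (h : I -> R -> R) (z : R) : reach a c h z -> exists ts, reach_at a c al ts h z.
Proof.
move=> [w [tw nz cz]]; exists [seq p.2 | p <- w], w; split=> //.
by apply/allP => p pw; apply/orP; right; apply: map_f.
Qed.

Lemma reach_at_reach (ts : seq R) (h : I -> R -> R) (z : R) : reach_at a c al ts h z -> reach a c h z.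
Proof. by move=> [w [tw nz cz _]]; exists w. Qed.

Lemma Hshift_top i (t : R) : 0 <= t <= 1 -> Hshift a H al (K 1) i t = H i t.
Proof.
move=> /andP[t0 t1]; apply: Hshift_below.
exact: rmax_mono.
Qed.

Lemma reach_raise (x z : R) : 0 < x -> x <= K 1 -> reach a c H z ->
  reach a c (Hshift a H al (K 1 - x)) (z + (c al)%:R * x).
Proof.
move=> x0 xK rz.
have /reach_reach_at[ts] : reach a c (Hshift a H al (K 1)) z.
  by apply: reach_ext rz => i t t01; rewrite Hshift_top.
have lo0 : 0 <= K 1 - x by lra.
have lohi : K 1 - x < K 1 by lra.
move=> /(reach_at_shift ts lo0 lohi (lexx _) z).1 /reach_at_reach.
by rewrite subKr.
Qed.

Lemma reach_lower (x z : R) : 0 < x -> x <= K 1 ->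
  reach a c (Hshift a H al (K 1 - x)) z -> reach a c H (z - (c al)%:R * x).
Proof.
move=> x0 xK /reach_reach_at[ts].
have lo0 : 0 <= K 1 - x by lra.
have lohi : K 1 - x < K 1 by lra.
move=> /(reach_at_shift ts lo0 lohi (lexx _) z).2 /reach_at_reach.
rewrite subKr; apply: reach_ext => i t t01; exact: Hshift_top.
Qed.

End ReachShift.


(** * The Weyl group and the roots *)
Section WeightReflection.
Variables (I : eqType) (a : I -> I -> int) (c : I -> nat).
Hypothesis a_diag : forall i, a i i = 2.
Hypothesis a_offdiag : forall i j, i != j -> a i j <= 0.
Hypothesis a_zero : forall i j, a i j = 0 -> a j i = 0.

Lemma del_sum (V : zmodType) (F : I -> V) i k (B B' : seq (I * unit)) :
  del i k B B' -> \sum_(j <- wletters B') F j = \sum_(j <- wletters B) F j - F i *+ k.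
Proof.
elim=> [B1|m B1 s B2 B'' _ ->]; first by rewrite mulr0n subr0.
rewrite /wletters !map_cat !big_cat /= big_cons mulrS.
by rewrite [X in _ = X - _]addrCA [F i + _]addrC addrKA.
Qed.

(** Weights are invariant under [s_i] because sl2 strings are symmetric. A weight is recorded
    through sums of an arbitrary [F], later the simple coroots. *)
Lemma wvec_reflect i w : wvec a c w != 0 -> exists w', wvec a c w' != 0 /\
  forall (V : zmodType) (F : I -> V),
    \sum_(j <- w') F j = \sum_(j <- w) F j + F i *~ hwt a c i w.
Proof.
pose B := [seq (j, tt) | j <- w].
have BE : wletters B = w by rewrite /wletters -map_comp map_id.
have cut N m x : (m <= N)%N -> iter N (fop a c i) x != 0 -> iter m (fop a c i) x != 0.
  move=> mN; apply: contraNneq => x0; rewrite -(subnK mN) iterD x0; apply/eqP.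
  exact: iter_lin0.
have powE m x : foldr (fop a c) x (nseq m i) = iter m (fop a c i) x.
  by elim: m => //= m ->.
(* Both moves on nonzero monomials are used with an empty left word and exponent 0; they give a
   nonzero power of [f_i] at least as high as wanted, and [cut] lowers it. *)
move=> nz; have nzB : wact a c ([::] : seq (I * unit)) (iter 0 (fop a c i) (tvec a c B)) != 0.
  by rewrite /= tvecE BE.
have [h0|h0] := leP 0 (hwt a c i w).
  have [N [k [A' [_ dA nzN]]]] := tvec_raise a_diag nzB.
  have A'0 : A' = [::].
    by move E: [::] dA => e dA; case: dA E => // m B1 s B2 B' _; case: B1.
  rewrite A'0 /= in nzN; rewrite BE => hN; exists (nseq `|hwt a c i w|%N i ++ w); split.
    rewrite /wvec foldr_cat -/(wvec a c w).
    have /cut/(_ nzN) : (`|hwt a c i w| <= N)%N by lia.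
    by rewrite powE tvecE BE.
  move=> V F; rewrite big_cat big_nseq iter_addr addr0 addrC; congr (_ + _).
  by rewrite pmulrn gez0_abs.
have [k [B' [dB nzk hk]]] := tvec_lower a_diag a_offdiag a_zero nzB.
have hB := hwt_del c a_diag dB; rewrite BE in hB.
pose m := `|hwt a c i w|%N.
(* Deleting [k] letters raises the weight by [2 k], so [hk] means [k >= m]; then [k - m] letters [i]
   are put back. *)
have mk : (m <= k)%N by rewrite /m; move: hk; rewrite hB; lia.
exists (nseq (k - m) i ++ wletters B'); split.
  rewrite /wvec foldr_cat -/(wvec a c _) -tvecE.
  have /cut/(_ nzk) : (k - m <= 0 + k)%N by lia.
  by rewrite powE.
move=> V F; rewrite big_cat /= big_nseq iter_addr addr0 (del_sum F dB) BE addrC -addrA.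
congr (_ + _).
have -> : hwt a c i w = - m%:Z by rewrite /m; lia.
have -> : F i *+ k = F i *+ (k - m) + F i *+ m by rewrite -mulrnDr subnK.
by rewrite mulrNz -pmulrn opprD addrAC addNr add0r.
Qed.

End WeightReflection.

Section Roots.
Variables (n r : nat) (g : kac_moody n r).
Local Notation sr := (sroot g).
Local Notation sc := (scoroot g).
Local Notation A := (cartan g).
Local Notation W := (weyl g).
Local Notation s_ := (srefl g).
Local Notation elt := (word_elt g).

Lemma srefl_col i m (x : 'M[int]_(r, m)) : s_ i *m x = x - sr i *m (sc i *m x).
Proof. by rewrite /srefl mulmxBl mul1mx mulmxA. Qed.

Lemma srefl_colE i (x : 'cV[int]_r) : s_ i *m x = x - (sc i *m x) 0 0 *: sr i.
Proof. by rewrite srefl_col [sc i *m x]mx11_scalar mul_mx_scalar -mx11_scalar. Qed.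

Lemma srefl_rowE i (v : 'rV[int]_r) : v *m s_ i = v - (v *m sr i) 0 0 *: sc i.
Proof.
by rewrite /srefl mulmxBr mulmx1 mulmxA [v *m sr i]mx11_scalar mul_scalar_mx -mx11_scalar.
Qed.

Lemma pairing_diag i : (sc i *m sr i) 0 0 = 2.
Proof. by rewrite cartan_pairing cartan_diag. Qed.

Lemma srefl_simple i : s_ i *m sr i = - sr i.
Proof. by rewrite srefl_colE pairing_diag scaler_nat mulr2n opprD addrA subrr sub0r. Qed.

Lemma srefl_sq i : s_ i *m s_ i = 1%:M.
Proof.
rewrite srefl_col srefl_rowE pairing_diag scaler_nat mulr2n opprD addrA subrr sub0r.
by rewrite mulmxN opprK /srefl subrK.
Qed.

Lemma word_elt_cat s t : elt (s ++ t) = elt s *m elt t.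
Proof. by elim: s => [|i s IH] /=; rewrite ?mul1mx // IH mulmxA. Qed.

Lemma word_elt_rcons s i : elt (rcons s i) = elt s *m s_ i.
Proof. by rewrite -cats1 word_elt_cat /= mulmx1. Qed.

Lemma word_elt_rev s : elt (rev s) *m elt s = 1%:M.
Proof.
elim: s => [|i s IH]; first by rewrite mul1mx.
by rewrite rev_cons word_elt_rcons /= mulmxA -[_ *m _ *m s_ i]mulmxA srefl_sq mulmx1.
Qed.

Lemma word_elt_unit s : elt s \in unitmx.
Proof. by have /mulmx1_unit[] := word_elt_rev s. Qed.

Lemma invmx_word s : invmx (elt s) = elt (rev s).
Proof.
by rewrite -[LHS]mul1mx -(word_elt_rev s) mulmxK // word_elt_unit.
Qed.

Lemma weyl_unit w : W w -> w \in unitmx.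
Proof. by move=> [s _ <-]; exact: word_elt_unit. Qed.

Lemma weyl1 : W 1%:M.
Proof. by exists [::]. Qed.

Lemma weylM w v : W w -> W v -> W (w *m v).
Proof. by move=> [s _ <-] [t _ <-]; exists (s ++ t) => //; rewrite word_elt_cat. Qed.

Lemma weyl_srefl i : W (s_ i).
Proof. by exists [:: i] => //=; rewrite mulmx1. Qed.

Lemma weylV w : W w -> W (invmx w).
Proof. by move=> [s _ <-]; exists (rev s) => //; rewrite invmx_word. Qed.

Lemma real_root_weyl w b : W w -> real_root g b -> real_root g (w *m b).
Proof.
by move=> Ww [v [i [Wv ->]]]; exists (w *m v), i; rewrite mulmxA; split=> //; exact: weylM.
Qed.

Lemma real_root_simple i : real_root g (sr i).
Proof. by exists 1%:M, i; rewrite mul1mx; split=> //; exact: weyl1. Qed.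

Lemma real_rootN b : real_root g b -> real_root g (- b).
Proof.
move=> [w [i [Ww ->]]]; exists (w *m s_ i), i; split.
  by apply: weylM => //; exact: weyl_srefl.
by rewrite -mulmxA srefl_simple mulmxN.
Qed.

Definition root_comb (x : 'I_n -> int) : 'cV[int]_r := \sum_i x i *: sr i.

Lemma root_comb_inj x y : root_comb x = root_comb y -> x =1 y.
Proof.
move=> E i; apply/eqP; rewrite -subr_eq0; apply/eqP.
apply: (@sroot_free _ _ g (fun i => x i - y i)).
rewrite (eq_bigr (fun j => x j *: sr j - y j *: sr j)) => [|j _]; last by rewrite scalerBl.
by rewrite sumrB -!/(root_comb _) E subrr.
Qed.

Lemma root_comb_simple i : root_comb (fun j => (j == i)%:R) = sr i.
Proof.
rewrite /root_comb (bigD1 i) //= eqxx scale1r big1 ?addr0 // => j /negPf ->.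
by rewrite scale0r.
Qed.

Lemma pairing_root_comb j x : (sc j *m root_comb x) 0 0 = \sum_i x i * A j i.
Proof.
rewrite /root_comb mulmx_sumr summxE; apply: eq_bigr => i _.
by rewrite -scalemxAr mxE cartan_pairing.
Qed.

Lemma srefl_root_comb j x : s_ j *m root_comb x =
  root_comb (fun i => x i - (i == j)%:R * \sum_k x k * A j k).
Proof.
rewrite srefl_colE pairing_root_comb; set t := \sum_k _.
rewrite /root_comb; under [RHS]eq_bigr do rewrite scalerBl.
rewrite sumrB; congr (_ - _).
rewrite (bigD1 j) //= eqxx mul1r big1 ?addr0 // => i /negPf ->.
by rewrite mul0r scale0r.
Qed.

Lemma real_root_comb b : real_root g b -> exists x, b = root_comb x.
Proof.
move=> [_ [i [[s _ <-] ->]]].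
elim: s => [|j s [x IH]]; first by rewrite mul1mx -root_comb_simple; eexists.
by rewrite /= -mulmxA IH srefl_root_comb; eexists.
Qed.

Lemma coroot_indep (x y : 'I_n -> int) :
  \sum_i x i *: sc i = \sum_i y i *: sc i -> x =1 y.
Proof.
have [om omE] := fundamental_weights g.
have E z j : ((\sum_i z i *: sc i) *m om j) 0 0 = z j.
  rewrite mulmx_suml summxE (bigD1 j) //= -scalemxAl mxE omE eqxx mulr1.
  by rewrite big1 ?addr0 // => i /negPf ij; rewrite -scalemxAl mxE omE ij mulr0.
by move=> xy j; rewrite -(E x) -(E y) xy.
Qed.

Section Fundamental.
Local Notation toQ := (map_mx (intr : int -> rat)).

(** The coefficients are rational because independent simple roots need not extend to a basis of the
    lattice. Independence passes from the integers to the rationals by clearing denominators. *)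
Lemma fundamental_coweights : exists om : 'I_n -> 'rV[rat]_r,
  forall l j, (om l *m toQ (sr j)) 0 0 = (l == j)%:R.
Proof.
pose S := \matrix_(j < n, k < r) (sr j k 0)%:~R : 'M[rat]_(n, r).
have : row_free S.
  apply: inj_row_free => v vS.
  pose D := \prod_i denq (v 0 i).
  pose m i := numq (v 0 i) * \prod_(k | k != i) denq (v 0 k).
  have mE i : (m i)%:~R = D%:~R * v 0 i :> rat.
    by rewrite /m /D [in RHS](bigD1 i) //= !intrM numqE; ring.
  have D0 : D%:~R != 0 :> rat by rewrite intr_eq0; apply/prodf_neq0 => i _; exact: denq_neq0.
  have m0 : forall i, m i = 0.
    apply: (@sroot_free _ _ g m); apply/matrixP => k o; rewrite (ord1 o) summxE mxE.
    apply/eqP; rewrite -(intr_eq0 rat) rmorph_sum /=; apply/eqP.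
    have /matrixP/(_ 0 k) := vS; rewrite !mxE => vk.
    under eq_bigr do rewrite mxE intrM mE -mulrA.
    rewrite -mulr_sumr -[RHS](mulr0 D%:~R) -[in RHS]vk; congr (_ * _).
    by apply: eq_bigr => i _; rewrite mxE.
  apply/matrixP => o i; rewrite (ord1 o) mxE; apply/eqP.
  by have := mE i; rewrite m0 => /esym/eqP; rewrite mulf_eq0 (negPf D0).
move=> /row_freeP[B SB]; exists (fun l => (col l B)^T) => l j.
have /matrixP/(_ j l) := SB; rewrite !mxE eq_sym => <-.
by apply: eq_bigr => k _; rewrite !mxE mulrC.
Qed.

End Fundamental.
End Roots.

(** * Every real root is positive or negative *)

Section SignCoherence.
Variables (n r : nat) (g : kac_moody n r).
Local Notation sr := (sroot g).
Local Notation sc := (scoroot g).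
Local Notation s_ := (srefl g).
Local Notation elt := (word_elt g).
Local Notation toQ := (map_mx (intr : int -> rat)).

(* Coweights are weights of the dual Kac-Moody algebra, whose Cartan matrix is
   transposed. *)
Definition dual_cartan (i j : 'I_n) : int := cartan g j i.

Lemma dual_cartan_diag i : dual_cartan i i = 2.
Proof. exact: cartan_diag. Qed.

Lemma dual_cartan_offdiag i j : i != j -> dual_cartan i j <= 0.
Proof. by move=> ij; apply: cartan_offdiag; rewrite eq_sym. Qed.

Lemma dual_cartan_zero i j : dual_cartan i j = 0 -> dual_cartan j i = 0.
Proof. exact: cartan_zero. Qed.

(* The weights of the module of highest weight [om l] are stable under the Weyl
   group, hence [om l - om l w] is a sum of simple coroots. *)
Lemma coweight_descent (om : 'I_n -> 'rV[rat]_r) w l :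
  (forall l j, (om l *m toQ (sr j)) 0 0 = (l == j)%:R) -> weyl g w ->
  exists t : seq 'I_n, om l *m toQ w = om l - \sum_(j <- t) toQ (sc j).
Proof.
move=> omE [s _ <-].
suff [t [_ tE]] : exists t, wvec dual_cartan (fun i => i == l : nat) t != 0 /\
    om l *m toQ (elt s) = om l - \sum_(j <- t) toQ (sc j) by exists t.
elim/last_ind: s => [|s j [t [nz IH]]].
  exists [::]; rewrite /= map_mx1 mulmx1 big_nil subr0; split=> //.
  by apply/eqP => /(congr1 (fun x => x [::])).
have [t' [nz' t'E]] :=
  wvec_reflect dual_cartan_diag dual_cartan_offdiag dual_cartan_zero j nz.
exists t'; split=> //; rewrite word_elt_rcons map_mxM mulmxA IH t'E.
have -> : toQ (s_ j) = 1%:M - toQ (sr j) *m toQ (sc j).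
  by rewrite /srefl map_mxB map_mx1 map_mxM.
rewrite mulmxBr mulmx1 mulmxA opprD addrA; congr (_ - _).
set v := _ *m toQ (sr j); suff -> : v = (hwt dual_cartan (fun i => i == l : nat) j t)%:~R%:M.
  by rewrite mul_scalar_mx scaler_int.
rewrite [LHS]mx11_scalar; congr (_%:M).
rewrite /v mulmxBl mulmx_suml mxE omE [in LHS]mxE summxE rmorphB /= -pmulrn.
congr (_ - _); first by rewrite eq_sym.
rewrite rmorph_sum; apply: eq_bigr => k _.
by rewrite -map_mxM mxE cartan_pairing.
Qed.

(** Suppose [x k < 0 < x l]. A combination [phi] of [om k] and [om l] with positive coefficients
    vanishes on the root, so the reflection [rw] in the root fixes it. But [rw] subtracts sums of
    simple coroots from [om k] and [om l]; these sums must be empty, so [rw] fixes [om l], against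
    [x l <> 0]. *)
Lemma real_root_coherent (x : 'I_n -> int) : real_root g (root_comb g x) ->
  (forall i, 0 <= x i) \/ (forall i, x i <= 0).
Proof.
move=> [w [i [Ww wE]]].
have [om omE] := fundamental_coweights g.
have xE l : (om l *m toQ w *m toQ (sr i)) 0 0 = (x l)%:~R.
  rewrite -mulmxA -map_mxM -wE /root_comb raddf_sum mulmx_sumr summxE (bigD1 l) //=.
  have scal k j : (om k *m toQ (x j *: sr j)) 0 0 = (x j)%:~R * (k == j)%:R.
    by rewrite map_mxZ -scalemxAr mxE omE.
  by rewrite scal eqxx mulr1 big1 ?addr0 // => j jl; rewrite scal eq_sym (negPf jl) mulr0.
apply: contrapT => /not_orP[/existsNP[k /negP]]; rewrite -ltNge => xk.
move=> /existsNP[l /negP]; rewrite -ltNge => xl.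
pose rw := w *m s_ i *m invmx w.
have Wr : weyl g rw by apply: weylM; [apply: weylM => //; exact: weyl_srefl|exact: weylV].
have [t1 t1E] := coweight_descent l omE Wr.
have [t2 t2E] := coweight_descent k omE Wr.
pose phi := (- x k)%:~R *: om l + (x l)%:~R *: om k.
have sE : toQ (s_ i) = 1%:M - toQ (sr i) *m toQ (sc i).
  by rewrite /srefl map_mxB map_mx1 map_mxM.
have fixw : phi *m toQ w *m toQ (s_ i) = phi *m toQ w.
  have z : phi *m toQ w *m toQ (sr i) = 0.
    apply/matrixP => a b; rewrite (ord1 a) (ord1 b) /phi !mulmxDl -!scalemxAl.
    by rewrite [LHS]mxE [X in X + _]mxE [X in _ + X]mxE !xE mxE intrN mulNr mulrC addNr.
  by rewrite sE mulmxBr mulmx1 mulmxA z mul0mx subr0.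
have Qinv : toQ w *m toQ (invmx w) = 1%:M.
  by rewrite -map_mxM mulmxV ?map_mx1 //; exact: weyl_unit Ww.
have fixr : phi *m toQ rw = phi.
  by rewrite /rw !map_mxM !mulmxA fixw -mulmxA Qinv mulmx1.
have sum0 : (- x k)%:~R *: (\sum_(j <- t1) toQ (sc j)) + (x l)%:~R *: (\sum_(j <- t2) toQ (sc j)) = 0.
  rewrite -[RHS](subrr phi) -[X in _ = _ - X]fixr /phi mulmxDl -!scalemxAl t1E t2E.
  by rewrite !scalerBr opprD addrACA !subKr.
have cnt t : \sum_(j <- t) toQ (sc j) = toQ (\sum_j (count_mem j t)%:Z *: sc j).
  elim: t => [|j0 t IH] /=.
    by rewrite big_nil big1 ?raddf0 // => j _; rewrite scale0r.
  rewrite big_cons IH -raddfD /=; congr (toQ _).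
  under [RHS]eq_bigr do rewrite PoszD scalerDl.
  rewrite big_split /=; congr (_ + _); rewrite (bigD1 j0) //= eqxx scale1r.
  by rewrite big1 ?addr0 // => j; rewrite eq_sym => /negPf ->; rewrite scale0r.
have t1nil : t1 = [::].
  case: t1 sum0 {t1E} => // j0 t1; rewrite !cnt -!map_mxZ -raddfD /= => /matrixP E.
  have {}E : \sum_j (- x k * (count_mem j (j0 :: t1))%:Z + x l * (count_mem j t2)%:Z) *: sc j =
      \sum_j 0 *: sc j.
    rewrite [RHS]big1 => [|j _]; last by rewrite scale0r.
    apply/matrixP => a b; have := E a b; rewrite [LHS]mxE [RHS]mxE => /eqP.
    rewrite intr_eq0 => /eqP X0; rewrite [RHS]mxE -X0.
    rewrite !scaler_sumr -big_split /=; congr (fun_of_matrix _ a b).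
    by apply: eq_bigr => j _; rewrite scalerDl !scalerA.
  have := coroot_indep E j0; rewrite /= eqxx.
  have : 0 < - x k * (true + count_mem j0 t1)%N%:Z by rewrite mulr_gt0 // oppr_gt0.
  have : 0 <= x l * (count_mem j0 t2)%:Z by rewrite mulr_ge0 // ltW.
  by move=> p1 p2 p3; move: p2; rewrite -(ltrD2r (x l * (count_mem j0 t2)%:Z)) p3 add0r ltNge p1.
have : om l *m toQ w *m toQ (s_ i) = om l *m toQ w.
  have <- : om l *m toQ rw *m toQ w = om l *m toQ w *m toQ (s_ i).
    rewrite /rw -mulmxA -map_mxM mulmxKV ?map_mxM ?mulmxA //.
    exact: weyl_unit Ww.
  by rewrite t1E t1nil big_nil subr0.
rewrite sE mulmxBr mulmx1 mulmxA => /eqP.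
rewrite -subr_eq0 addrAC subrr sub0r oppr_eq0.
rewrite [_ *m toQ (sr i)]mx11_scalar xE mul_scalar_mx => /eqP z.
have : ((x l)%:~R *: toQ (sc i) *m toQ (sr i)) 0 0 = 0 by rewrite z mul0mx mxE.
rewrite -scalemxAl mxE -map_mxM mxE pairing_diag => /eqP.
by rewrite mulf_eq0 !intr_eq0 /= orbF => /eqP xl0; rewrite xl0 ltxx in xl.
Qed.

Lemma pos_real_rootP b : real_root g b ->
  pos_real_root g b \/ pos_real_root g (- b).
Proof.
move=> rb; have [x bE] := real_root_comb rb; rewrite bE in rb *.
have [x0|x0] := real_root_coherent rb; [left|right].
  split=> //; exists (fun i => `|x i|%N); apply: eq_bigr => i _.
  by rewrite gez0_abs.
split; first exact: real_rootN; exists (fun i => `|x i|%N).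
rewrite /root_comb -sumrN; apply: eq_bigr => i _.
by rewrite lez0_abs // scaleNr.
Qed.

Lemma pos_real_root_simple i : pos_real_root g (sr i).
Proof.
split; first exact: real_root_simple.
exists (fun j => (j == i)); rewrite -root_comb_simple; apply: eq_bigr => j _.
by rewrite natz.
Qed.

Lemma simple_neq0 i : sr i != 0.
Proof.
apply/eqP => z; have := pairing_diag g i; rewrite z mulmx0 mxE => /eqP.
by rewrite eq_sym.
Qed.

Lemma pos_real_root_neg b : pos_real_root g b -> ~ pos_real_root g (- b).
Proof.
move=> [rb [c1 E1]] [_ [c2 E2]].
have : root_comb g (fun i => (c1 i)%:Z + (c2 i)%:Z) = root_comb g (fun=> 0).
  rewrite /root_comb [RHS]big1 => [|i _]; last by rewrite scale0r.
  under eq_bigr do rewrite scalerDl.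
  by rewrite big_split /= -E1 -E2 subrr.
move=> /root_comb_inj E.
have b0 : b = 0.
  by rewrite E1 big1 // => i _; have : c1 i = 0%N by [have := E i; lia]; move=> ->; rewrite scale0r.
have [w [i [Ww wE]]] := rb; have := simple_neq0 i.
have : invmx w *m b = sr i by rewrite wE mulKmx //; exact: (weyl_unit Ww).
by rewrite b0 mulmx0 => <-; rewrite eqxx.
Qed.

(** [sr j] is [k] times the root [invmx w *m sr i], whose coefficients are integers, so [k] divides
    1. *)
Lemma pos_multiple_simple i (k : int) : real_root g (k *: sr i) -> 0 < k -> k = 1.
Proof.
move=> [w [j [Ww wE]]] k0.
have rz : real_root g (invmx w *m sr i).
  by apply: real_root_weyl; [exact: weylV|exact: real_root_simple].
have [z zE] := real_root_comb rz.
have : root_comb g (fun l => (l == j)%:R) = root_comb g (fun l => k * z l).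
  rewrite root_comb_simple /root_comb; under [RHS]eq_bigr do rewrite -scalerA.
  rewrite -scaler_sumr -/(root_comb g z) -zE scalemxAr wE mulKmx //.
  exact: (weyl_unit Ww).
move=> /root_comb_inj/(_ j); rewrite eqxx => /esym kz.
have kn : k = `|k|%N%:Z by rewrite gtz0_abs.
have zn : 0 < z j by rewrite -(pmulr_rgt0 _ k0) kz.
have : (`|k| * `|z j|)%N = 1%N by lia.
by move=> /eqP; rewrite muln_eq1 => /andP[/eqP k1 _]; rewrite kn k1.
Qed.

(** [s_ i] alters only the coefficient of [sr i]. Another positive coefficient keeps the image
    positive by sign coherence; if there is none, [b] is a multiple of [sr i]. *)
Lemma pos_real_root_srefl i b : pos_real_root g b -> b <> sr i ->
  pos_real_root g (s_ i *m b).
Proof.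
move=> pb bi; have [rb [c cE]] := pb.
have rsb : real_root g (s_ i *m b) by apply: real_root_weyl => //; exact: weyl_srefl.
have [[j ji cj]|none] : (exists2 j, j != i & (0 < c j)%N) \/ forall j, j != i -> c j = 0%N.
- apply: contrapT => /not_orP[H1 H2]; apply: H2 => j ji.
  by apply/eqP; rewrite -leqn0 leqNgt; apply/negP => cj; apply: H1; exists j.
- have [//|[_ [c' c'E]]] := pos_real_rootP rsb.
  have sE := srefl_root_comb g i (fun l => (c l)%:Z).
  rewrite /root_comb -cE in sE; rewrite sE in c'E.
  have : root_comb g (fun l => (c' l)%:Z) =
      root_comb g (fun l => - ((c l)%:Z - (l == i)%:R * \sum_k (c k)%:Z * cartan g i k)).
    rewrite {1}/root_comb -c'E /root_comb -sumrN.
    by apply: eq_bigr => l _; rewrite scaleNr.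
  move=> /root_comb_inj/(_ j) /=; rewrite (negPf ji) mul0r subr0; lia.
have bE : b = (c i)%:Z *: sr i.
  rewrite cE (bigD1 i) //= big1 ?addr0 // => j /none ->; exact: scale0r.
have ci0 : 0 < (c i)%:Z.
  rewrite lt_neqAle eq_sym; apply/andP; split => //; apply/eqP => ci.
  apply: (pos_real_root_neg pb).
  by rewrite bE ci scale0r oppr0 -(scale0r (sr i)) -ci -bE.
rewrite bE in rb; have c1 := pos_multiple_simple rb ci0.
by case: bi; rewrite bE c1 scale1r.
Qed.

End SignCoherence.

(** * Coroots, the exchange condition and inversion sets *)

Section Coroots.
Variables (n r : nat) (g : kac_moody n r).
Hypothesis gsym : symmetrizable g.
Local Notation sr := (sroot g).
Local Notation sc := (scoroot g).
Local Notation s_ := (srefl g).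
Local Notation elt := (word_elt g).

Lemma symmetrizer : exists d : 'I_n -> int, (forall i, 0 < d i) /\
  forall i j, d i * cartan g i j = d j * cartan g j i.
Proof.
have [d [d0 dA]] := gsym; exists (d 0); split=> // i j.
by have /matrixP/(_ j i) := dA; rewrite mxE !mul_diag_mx !mxE.
Qed.

(* The equivariant map [sr i |-> d i *: sc i] from the root lattice to the
   coroot lattice. *)
Definition nu_rel (d : 'I_n -> int) (b : 'cV[int]_r) (v : 'rV[int]_r) :=
  exists x, b = root_comb g x /\ v = \sum_i (x i * d i) *: sc i.

Section Nu.
Variable d : 'I_n -> int.
Hypothesis d_gt0 : forall i, 0 < d i.
Hypothesis dA : forall i j, d i * cartan g i j = d j * cartan g j i.

Lemma nu_rel_fun b v v' : nu_rel d b v -> nu_rel d b v' -> v = v'.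
Proof.
by move=> [x [-> ->]] [y [/root_comb_inj xy ->]]; apply: eq_bigr => i _; rewrite xy.
Qed.

Lemma nu_rel_srefl i b v : nu_rel d b v -> nu_rel d (s_ i *m b) (v *m s_ i).
Proof.
move=> [x [-> ->]]; rewrite srefl_root_comb; eexists; split; first reflexivity.
rewrite srefl_rowE; set S := \sum_k x k * _.
have -> : ((\sum_k (x k * d k) *: sc k) *m sr i) 0 0 = d i * S.
  rewrite mulmx_suml summxE /S mulr_sumr; apply: eq_bigr => k _.
  by rewrite -scalemxAl mxE cartan_pairing -mulrA dA mulrCA.
under [RHS]eq_bigr do rewrite mulrBl scalerBl.
rewrite sumrB; congr (_ - _); rewrite (bigD1 i) //= eqxx mul1r mulrC.
by rewrite big1 ?addr0 // => k /negPf ->; rewrite !mul0r scale0r.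
Qed.

Lemma nu_rel_coroot b v : is_coroot g b v ->
  exists2 i, nu_rel d b (d i *: v) & (v *m b) 0 0 = 2.
Proof.
move=> [w [i [[s _ <-] -> ->]]]; exists i; last first.
  by rewrite mulmxA mulmxKV ?word_elt_unit // pairing_diag.
rewrite invmx_word; elim: s => [|j s IH].
  rewrite mul1mx mulmx1 -root_comb_simple; eexists; split; first reflexivity.
  rewrite (bigD1 i) //= eqxx mul1r big1 ?addr0 // => k /negPf ->.
  by rewrite mul0r scale0r.
rewrite rev_cons word_elt_rcons /= -[s_ j *m _ *m _]mulmxA [sc i *m (_ *m _)]mulmxA scalemxAl.
exact: nu_rel_srefl.
Qed.

End Nu.

(** Positive multiples of [v] and [v'] both equal the image of [b] under the symmetrizing map, and
    both take the value 2 on [b]. So the choice made by [xget] in [coroot] is harmless. *)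
Lemma is_coroot_inj b v v' : is_coroot g b v -> is_coroot g b v' -> v = v'.
Proof.
have [d [d0 dA]] := symmetrizer.
move=> /(nu_rel_coroot dA)[i iv v2] /(nu_rel_coroot dA)[j jv v'2].
have E := nu_rel_fun iv jv.
have : (d i *: v *m b) 0 0 = (d j *: v' *m b) 0 0 by rewrite E.
rewrite -!scalemxAl [LHS]mxE [RHS]mxE v2 v'2 => /(mulIf _) dij.
rewrite -dij // in E; apply/matrixP => k l; have /matrixP/(_ k l) := E.
by rewrite !mxE => /mulfI; apply; rewrite gt_eqF.
Qed.

Lemma corootP b : real_root g b -> is_coroot g b (coroot g b).
Proof.
move=> [w [i [Ww bE]]]; apply: xgetPex; exists (sc i *m invmx w), w, i.
by split.
Qed.

Lemma corootE b v : is_coroot g b v -> coroot g b = v.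
Proof.
move=> bv; apply: is_coroot_inj (bv); apply: corootP.
by have [w [i [Ww bE _]]] := bv; exists w, i.
Qed.

Lemma coroot_simple i : coroot g (sr i) = sc i.
Proof.
apply: corootE; exists 1%:M, i; rewrite mul1mx invmx1 mulmx1.
by split=> //; exact: weyl1.
Qed.

Lemma coroot_weyl w b : weyl g w -> real_root g b ->
  coroot g (w *m b) = coroot g b *m invmx w.
Proof.
move=> Ww /corootP[v [i [Wv bE cE]]]; apply: corootE; exists (w *m v), i.
split; [exact: weylM|by rewrite bE mulmxA|].
have [s _ sE] := Ww; have [t _ tE] := Wv.
rewrite cE -sE -tE -word_elt_cat !invmx_word rev_cat word_elt_cat.
by rewrite mulmxA.
Qed.

Lemma coroot_srefl i b : real_root g b ->
  coroot g (s_ i *m b) = coroot g b *m s_ i.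
Proof.
move=> rb; rewrite coroot_weyl //; last exact: weyl_srefl.
congr (_ *m _); have := invmx_word g [:: i].
by rewrite /rev /= mulmx1.
Qed.

Lemma pos_coroot b : pos_real_root g b -> exists (e : int) (x : 'I_n -> int),
  [/\ 0 < e, forall i, 0 <= x i & e *: coroot g b = \sum_i x i *: sc i].
Proof.
have [d [d0 dA]] := symmetrizer.
move=> [/corootP/(nu_rel_coroot dA)[i [x [bE vE]] _] [c cE]].
have xc : x =1 (fun i => (c i)%:Z) by apply: (@root_comb_inj _ _ g); rewrite -bE.
exists (d i), (fun k => x k * d k); split=> // k.
by rewrite xc mulr_ge0 // ltW.
Qed.

Definition root_refl (b : 'cV[int]_r) : 'M[int]_r := 1%:M - b *m coroot g b.

(** If the tail of the word already makes [b] negative, induction applies. Otherwise [s_ i] makes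
    the positive root [elt s *m b] negative, so this root is [sr i], and deleting [i] is the same as
    multiplying by the reflection in [b]. *)
Lemma exchange s b : pos_real_root g b -> pos_real_root g (- (elt s *m b)) ->
  exists2 s', (size s' < size s)%N & elt s' = elt s *m root_refl b.
Proof.
elim: s => [|i s IH] pb /=.
  by rewrite mul1mx => /(pos_real_root_neg pb).
move=> neg; have rb := pb.1.
have rsb : real_root g (elt s *m b) by apply: real_root_weyl => //; exists s.
have [pos|ngs] := pos_real_rootP rsb; last first.
  have [s' ss' E] := IH pb ngs; exists (i :: s') => //=.
  by rewrite E mulmxA.
have [E|nE] := pselect (elt s *m b = sr i); last first.
  have := pos_real_root_srefl pos nE; rewrite mulmxA => /pos_real_root_neg.
  by move=> /(_ neg).
exists s => //.
have cE : coroot g b = sc i *m elt s.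
  have Ws : weyl g (elt s) by exists s.
  have := coroot_weyl Ws rb; rewrite E coroot_simple => ->.
  by rewrite mulmxKV // word_elt_unit.
have sb : elt s *m (1%:M - b *m (sc i *m elt s)) = s_ i *m elt s.
  by rewrite mulmxBr mulmx1 [elt s *m (b *m _)]mulmxA E srefl_col.
by rewrite /root_refl cE -[s_ i *m elt s *m _]mulmxA sb mulmxA srefl_sq mul1mx.
Qed.

Lemma is_length_ex w : weyl g w -> is_length g w (weyl_length g w).
Proof.
move=> [s _ sE]; apply: xgetPex.
pose P k := `[< exists2 t, size t = k & elt t = w >].
have exP : exists k, P k by exists (size s); apply/asboolP; exists s.
have [k /asboolP[t tk tw] kmin] := ex_minnP exP.
exists k; split; first by exists t.
by move=> u uw; apply: kmin; apply/asboolP; exists u.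
Qed.

Variable R : realType.
Local Notation XR := 'cV[R]_r.

Lemma pairing_weyl_act w (x : XR) bv : pairing (weyl_act w x) bv = pairing x (bv *m w).
Proof. by rewrite /pairing /weyl_act map_mxM mulmxA. Qed.

Lemma pairingD (x y : XR) bv : pairing (x + y) bv = pairing x bv + pairing y bv.
Proof. by rewrite /pairing mulmxDr mxE. Qed.

Lemma pairingZ k (x : XR) bv : pairing (k *: x) bv = k * pairing x bv.
Proof. by rewrite /pairing -scalemxAr mxE. Qed.

Lemma pairing_toXR (x : 'cV[int]_r) bv : pairing (toXR R x) bv = ((bv *m x) 0 0)%:~R.
Proof. by rewrite /pairing /toXR -map_mxM mxE. Qed.

Lemma dominant_pos (x : XR) b : dominant g x -> pos_real_root g b ->
  0 <= pairing x (coroot g b).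
Proof.
move=> dx /pos_coroot[e [c [e0 c0 E]]].
rewrite -(pmulr_rge0 (x := e%:~R)) ?ltr0z //.
have -> : e%:~R * pairing x (coroot g b) = pairing x (e *: coroot g b).
  by rewrite /pairing map_mxZ -scalemxAl [RHS]mxE.
rewrite E /pairing raddf_sum mulmx_suml summxE; apply: sumr_ge0 => i _.
by rewrite /= map_mxZ -scalemxAl mxE mulr_ge0 ?ler0z //; exact: dx.
Qed.

Lemma weyl_act_root_refl (x : XR) w b : pairing x (coroot g b) = 0 ->
  weyl_act (w *m root_refl b) x = weyl_act w x.
Proof.
rewrite /pairing => z; rewrite /weyl_act /root_refl mulmxBr mulmx1 mulmxA map_mxB.
rewrite mulmxBl map_mxM -!mulmxA [map_mx intr (coroot g b) *m x]mx11_scalar z.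
by rewrite -scalemx1 scale0r !mulmx0 subr0.
Qed.

(* If [w b < 0] and [x] were fixed by the reflection in [b], exchange would
   give a shorter dominating element. *)
Lemma inversion_set_min (x : XR) w : min_dominating g x w ->
  inversion_set g w = [set b | pos_real_root g b /\ pairing x (coroot g b) < 0].
Proof.
move=> [Ww dom wmin].
have pE b : real_root g b ->
    pairing x (coroot g b) = pairing (weyl_act w x) (coroot g (w *m b)).
  move=> rb; rewrite pairing_weyl_act coroot_weyl // mulmxKV //.
  exact: weyl_unit Ww.
have nE b : real_root g b ->
    pairing x (coroot g b) = - pairing (weyl_act w x) (coroot g (- (w *m b))).
  move=> rb; rewrite pE //; have rwb := real_root_weyl Ww rb.
  suff -> : coroot g (- (w *m b)) = - coroot g (w *m b).
    by rewrite /pairing map_mxN mulNmx [in RHS]mxE opprK.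
  have [v [i [Wv bE cE]]] := corootP rwb.
  apply: corootE; exists (v *m s_ i), i; split.
  - by apply: weylM => //; exact: weyl_srefl.
  - by rewrite bE -mulmxA srefl_simple mulmxN.
  have [t _ tE] := Wv; rewrite cE -tE -word_elt_rcons !invmx_word rev_rcons /=.
  rewrite mulmxA srefl_rowE pairing_diag scaler_nat mulr2n opprD addrA subrr sub0r.
  by rewrite mulNmx.
apply/seteqP; split=> b /= [pb].
  move=> ngb; split=> //; rewrite (nE b pb.1) oppr_lt0 lt_neqAle.
  rewrite (dominant_pos dom ngb) andbT eq_sym; apply/eqP => z.
  have xb0 : pairing x (coroot g b) = 0 by rewrite (nE b pb.1) z oppr0.
  have [[s sl sE] _] := is_length_ex Ww.
  rewrite -sE in ngb; have [s' ss' s'E] := exchange pb ngb.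
  have Ws' : weyl g (elt s') by exists s'.
  have := wmin _ Ws'; rewrite s'E sE weyl_act_root_refl // => /(_ dom).
  rewrite -sE -s'E; have [_ lmin] := is_length_ex Ws'.
  by rewrite sE -sl leqNgt => /negP; apply; exact: leq_ltn_trans (lmin s' erefl) ss'.
move=> xneg; split=> //.
have [pos|//] := pos_real_rootP (real_root_weyl Ww pb.1).
by have := dominant_pos dom pos; rewrite -(pE b pb.1) leNgt xneg.
Qed.

End Coroots.


(** * Root operators *)
Section Reparametrization.
Variable R : realType.

Definition monotone_onto (phi : R -> R) :=
  [/\ cont01 phi, forall t, 0 <= t <= 1 -> 0 <= phi t <= 1,
      forall s t, 0 <= s <= 1 -> 0 <= t <= 1 -> s <= t -> phi s <= phi t
    & forall t, 0 <= t <= 1 -> exists2 s, 0 <= s <= 1 & phi s = t].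

Lemma is_reparam_onto phi : is_reparam phi -> monotone_onto phi.
Proof.
move=> [mono onto /cont01P pc]; split=> [//|t t01|s t s01 t01 st|t t01].
- have : [set phi x | x in `[0, 1]%classic] (phi t) by exists t => //=; rewrite in_itv.
  by rewrite onto /= in_itv.
- by apply: mono => //; rewrite in_itv.
- have : `[0, 1]%classic t by rewrite /= in_itv.
  by rewrite -onto => -[s /=]; rewrite in_itv /= => s01 <-; exists s.
Qed.

Lemma monotone_onto_rev phi : monotone_onto phi ->
  monotone_onto (fun t => 1 - phi (1 - t)).
Proof.
move=> [pc p01 pm ps]; split=> [|t t01|s t s01 t01 st|t t01].
- apply: cont01D (cont01N (cont01_rev pc)) => t _ e e0.
  by exists 1 => // s _ _; rewrite subrr normr0.
- by have := p01 (1 - t); lra.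
- by have := pm (1 - t) (1 - s); lra.
- have [|s s01 E] := ps (1 - t); first by lra.
  by exists (1 - s); [lra|rewrite subKr E subKr].
Qed.

(** Just to the right of [t], [h] is read at preimages just after the last time [b] with
    [phi b = t]. *)
Lemma quotient_right (h phi : R -> R) : monotone_onto phi ->
  cont01 (fun t => h (phi t)) -> forall t, 0 <= t <= 1 -> forall e, 0 < e ->
  exists2 d, 0 < d & forall s, 0 <= s <= 1 -> t <= s -> s < t + d -> `|h s - h t| < e.
Proof.
move=> [pc p01 pm ps] hc t t01 e e0.
have [a a01 aE] := ps t t01.
have [||||b [ab _ after /(_ _)bE]] := @last_below R phi a 1 t pc; rewrite ?aE //; try lra.
have {}bE : phi b = t.
  apply: bE; rewrite -aE; apply: pm; lra.
have b01 : 0 <= b <= 1 by lra.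
have [b1|b1] := eqVneq b 1.
  exists 1 => // s s01 ts _; have [v v01 vE] := ps s s01.
  have : phi v <= phi b by apply: pm => //; lra.
  rewrite vE bE => st; have -> : s = t by lra.
  by rewrite subrr normr0.
have {}b1 : b < 1 by rewrite lt_neqAle b1; lra.
have [d d0 dh] := hc b b01 e e0.
pose m := Num.min (d / 2) (1 - b).
have mpos : 0 < m by rewrite lt_min; lra.
have m1 : m <= d / 2 by rewrite ge_min lexx.
have m2 : m <= 1 - b by rewrite ge_min lexx orbT.
exists (phi (b + m) - t).
  by have := after (b + m); have -> : b < b + m <= 1 by [lra]; move=> /(_ isT); lra.
move=> s s01; rewrite le_eqVlt => /predU1P[<- _|ts sd].
  by rewrite subrr normr0.
have [v v01 vE] := ps s s01.
have bv : b < v.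
  rewrite ltNge; apply/negP => vb; have := pm v b v01 b01 vb; rewrite vE bE; lra.
have vm : v <= b + m.
  rewrite leNgt; apply/negP => mv; have := pm (b + m) v; rewrite vE; lra.
have := dh v v01; rewrite vE bE; apply.
by rewrite gtr0_norm; lra.
Qed.

(** Serves the clause [crystal_unreparam], whose new path is known only through its composite with
    [phi]. *)
Lemma cont01_quotient (h phi : R -> R) : monotone_onto phi ->
  cont01 (fun t => h (phi t)) -> cont01 h.
Proof.
move=> mp hc t t01 e e0; have [d d0 dh] := quotient_right mp hc t01 e0.
have [|||d' d'0 dh'] := @quotient_right (fun t => h (1 - t)) _ (monotone_onto_rev mp) _ (1 - t) _ e.
- move=> u u01 e' e'0; have [|d1 d10 dh1] := hc (1 - u) _ e' e'0; first by lra.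
  exists d1 => // s s01 su; rewrite !subKr; apply: dh1; first by lra.
  have -> : 1 - s - (1 - u) = - (s - u) by ring.
  by rewrite normrN.
- by lra.
- by [].
exists (Num.min d d'); first by rewrite lt_min d0.
move=> s s01; rewrite lt_min => /andP[sd sd'].
have [ts|st] := leP t s; first by apply: dh => //; move: sd; rewrite ger0_norm; lra.
have := dh' (1 - s); rewrite !subKr; apply; [lra|lra|].
by move: sd'; rewrite ltr0_norm; lra.
Qed.

Lemma cont01_comp (h phi : R -> R) : monotone_onto phi ->
  cont01 h -> cont01 (fun t => h (phi t)).
Proof.
move=> [pc p01 _ _] hc t t01 e e0; have [d d0 dh] := hc _ (p01 t t01) e e0.
have [d' d'0 dh'] := pc t t01 d d0; exists d' => // s s01 st.
by apply: dh; [exact: p01|exact: dh'].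
Qed.

Lemma cont01_ext (h k : R -> R) : (forall t, 0 <= t <= 1 -> h t = k t) ->
  cont01 h -> cont01 k.
Proof.
move=> E hc t t01 e e0; have [d d0 dh] := hc t t01 e e0.
by exists d => // s s01 st; rewrite -!E //; exact: dh.
Qed.

End Reparametrization.

(** * The root operators in terms of a single height function *)

Section RaisingLowering.
Variables (R : realType) (h : R -> R).
Hypothesis hc : cont01 h.
Hypothesis h0 : h 0 = 0.
Local Notation K := (rmax h).

Lemma inf_cap (S : set R) (F : R -> R) s0 : S s0 -> (forall s, S s -> F s0 <= F s) ->
  inf (1 |` [set F s | s in S]) = Num.min 1 (F s0).
Proof.
move=> Ss0 Fmin; set E := (X in inf X).
have lb : lbound E (Num.min 1 (F s0)).
  move=> y [->|[s Ss <-]]; first by rewrite ge_min lexx.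
  by rewrite ge_min Fmin ?orbT.
have Em : E (Num.min 1 (F s0)).
  by have [_|_] := leP 1 (F s0); [left|right; exists s0].
apply/eqP; rewrite eq_le; apply/andP; split.
  by apply: ge_inf => //; exists (Num.min 1 (F s0)).
by apply: lb_le_inf => //; exists (Num.min 1 (F s0)).
Qed.

Lemma inf_rmax t : inf [set h s | s in `[0, t]%classic] = - K t.
Proof.
rewrite /inf /rmax; congr (- sup _); apply/seteqP; split=> y /=.
  by move=> [_ [s st <-] <-]; exists s.
by move=> [s st <-]; exists (h s) => //; exists s.
Qed.

Definition lowering (t : R) : R :=
  inf (1 |` [set h s + K 1 | s in `[t, 1]%classic]).

Definition raising (t : R) : R :=
  1 - inf (1 |` [set h s + K 1 | s in `[0, t]%classic]).

Lemma raisingE t : 0 <= t <= 1 -> raising t = Num.max 0 (K t - (K 1 - 1)).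
Proof.
move=> t01; have [s st Ks] := rmax_ex hc t01.
rewrite /raising (@inf_cap _ _ s) /= ?in_itv //=.
  by rewrite Ks; have [H|H] := leP 1 (h s + K 1); have [H'|H'] := leP 0 (- h s - (K 1 - 1)); lra.
move=> u; rewrite in_itv /= => ut; have := @rmax_ge R h hc u t.
by rewrite Ks; lra.
Qed.

Lemma lowering_ex t : 0 <= t <= 1 -> exists s, [/\ t <= s <= 1,
  lowering t = Num.min 1 (h s + K 1) & forall u, t <= u <= 1 -> h s <= h u].
Proof.
move=> t01; have [|||s st smax] := @cont01_max R (fun t => - h t) t 1 (cont01N hc); try lra.
exists s; split=> // [|u /smax]; last by lra.
rewrite /lowering (@inf_cap _ _ s) /= ?in_itv //= => u; rewrite in_itv /= => /smax; lra.
Qed.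

Lemma lowering_le1 t : 0 <= t <= 1 -> lowering t <= 1.
Proof. by move=> /lowering_ex[s [_ -> _]]; rewrite ge_min lexx. Qed.

Lemma lowering_le t u : 0 <= t <= 1 -> t <= u <= 1 -> lowering t <= h u + K 1.
Proof. by move=> /lowering_ex[s [_ -> smin]] /smin hu; rewrite ge_min lerD2r hu orbT. Qed.

Lemma le_lowering t x : 0 <= t <= 1 -> x <= 1 ->
  (forall u, t <= u <= 1 -> x <= h u + K 1) -> x <= lowering t.
Proof. by move=> /lowering_ex[s [st -> _]] x1 H; rewrite le_min x1 H. Qed.

Lemma lowering_ge0 t : 0 <= t <= 1 -> 0 <= lowering t.
Proof.
move=> t01; apply: le_lowering => // u tu.
by have := @rmax_ge R h hc u 1; lra.
Qed.

Lemma lowering_mono s t : 0 <= s -> s <= t -> t <= 1 -> lowering s <= lowering t.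
Proof.
move=> s0 st t1; apply: le_lowering => [||u tu]; [lra|apply: lowering_le1; lra|].
by apply: lowering_le; lra.
Qed.

(** Before [t], [h] attains its minimum [- K 1]; [s] is the last time up to [t] when [h] is at most
    [lowering t - K 1]. *)
Lemma lowering_attained t : 0 <= t <= 1 -> 0 < lowering t ->
  exists2 s, 0 <= s <= t & h s + K 1 = lowering t /\ lowering s = lowering t.
Proof.
move=> t01 L0; have [|s1 s1_01 Ks1] := @rmax_ex R h hc 1; first by lra.
have s1t : s1 < t.
  rewrite ltNge; apply/negP => ts1; have := lowering_le (u := s1) t01; rewrite Ks1.
  by have -> : t <= s1 <= 1 by [lra]; move=> /(_ isT); lra.
have hu u : t <= u <= 1 -> lowering t - K 1 <= h u.
  by move=> /(lowering_le t01); lra.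
have [||||s [st _ after eq]] := @last_below R h s1 t (lowering t - K 1) hc; try lra.
have hs : h s = lowering t - K 1 by apply: eq; apply: hu; lra.
have s01 : 0 <= s <= 1 by lra.
exists s; first by lra.
split; first by rewrite hs subrK.
apply/eqP; rewrite eq_le lowering_mono //=; [|lra|lra|lra].
apply: le_lowering => // [|u su]; first exact: lowering_le1.
have [ut|tu] := leP u t.
  have [us|us] := eqVneq u s; first by rewrite us hs; lra.
  by have := after u; have -> : s < u <= t by [rewrite lt_neqAle eq_sym us /=; lra]; move=> /(_ isT); lra.
by have := hu u; have -> : t <= u <= 1 by [lra]; move=> /(_ isT); lra.
Qed.

Lemma lowering0 : lowering 0 = 0.
Proof.
have t01 : 0 <= (0 : R) <= 1 by lra.
apply/eqP; rewrite eq_le lowering_ge0 // andbT.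
have [|s s01 Ks] := @rmax_ex R h hc 1; first by lra.
have := lowering_le (u := s) t01; rewrite Ks; have -> : 0 <= s <= 1 by lra.
by move=> /(_ isT); lra.
Qed.

Lemma lowering_cont : cont01 lowering.
Proof.
pose hr t := h (1 - t); have hrc : cont01 hr := cont01_rev hc.
have E t : 0 <= t <= 1 -> lowering t = Num.min 1 (K 1 - rmax hr (1 - t)).
  move=> t01; have [s [st -> smin]] := lowering_ex t01.
  congr (Num.min 1 _); rewrite addrC; congr (_ + _).
  have [|u ut Ku] := @rmax_ex R hr hrc (1 - t); first by lra.
  have H1 := smin (1 - u); have := @rmax_ge R hr hrc (1 - s) (1 - t).
  by rewrite Ku /hr subKr; move: H1; lra.
apply: (cont01_ext (h := fun t => Num.min 1 (K 1 - rmax hr (1 - t)))).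
  by move=> t t01; rewrite E.
apply: (cont01_lip (C := 1) (cont01_rev (rmax_cont hrc))) => s t _ _.
rewrite mul1r; set x := rmax hr (1 - s); set y := rmax hr (1 - t).
have [H1|H1] := leP 1 (K 1 - x); have [H2|H2] := leP 1 (K 1 - y);
  have := ler_norm (x - y); have := ler_norm (y - x); rewrite [`|y - x|]distrC => H3 H4;
  rewrite ler_norml; lra.
Qed.

End RaisingLowering.

Section RaisingLoweringInverse.
Variable R : realType.
Implicit Types h k : R -> R.

Lemma rmax_ext h k t : (forall s, 0 <= s <= 1 -> h s = k s) -> 0 <= t <= 1 ->
  rmax h t = rmax k t.
Proof.
move=> E t01; rewrite /rmax; congr sup; apply/seteqP; split=> y [s /=];
  rewrite in_itv /= => st <-; exists s; rewrite /= ?in_itv ?E //; lra.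
Qed.

Variable h : R -> R.
Hypothesis hc : cont01 h.
Hypothesis h0 : h 0 = 0.
Local Notation K := (rmax h).

Lemma rmax_eq k t x : cont01 k -> 0 <= t <= 1 ->
  (forall s, 0 <= s <= t -> - k s <= x) -> (exists2 s, 0 <= s <= t & x <= - k s) ->
  rmax k t = x.
Proof.
move=> kc t01 ub [s st xs]; apply/eqP; rewrite eq_le; apply/andP; split.
  by have [u /ub + ->] := rmax_ex kc t01.
by have := @rmax_ge R k kc s t; lra.
Qed.

Lemma max0_cont k : cont01 k -> cont01 (fun t => Num.max 0 (k t)).
Proof.
move=> kc; apply: (cont01_lip (C := 1) kc) => s t _ _; rewrite mul1r.
have [H1|H1] := leP 0 (k s); have [H2|H2] := leP 0 (k t);
  have := ler_norm (k s - k t); have := ler_norm (k t - k s);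
  rewrite [`|k t - k s|]distrC => H3 H4; rewrite ler_norml; lra.
Qed.

Lemma cont01Z c k : cont01 k -> cont01 (fun t => c * k t).
Proof.
move=> kc; apply: (cont01_lip (C := `|c|) kc) => s t _ _.
by rewrite -mulrBr normrM.
Qed.

Lemma shift_cont c th : cont01 (fun t => c * Num.max 0 (K t - th)).
Proof.
apply: cont01Z; apply: max0_cont; apply: (cont01_lip (C := 1) (rmax_cont hc)) => s t _ _.
by rewrite mul1r opprB addrA subrK.
Qed.

(** The added term keeps the running minimum from passing [- th], a value attained at the first time
    [tau] when [K] reaches [th]. *)
Lemma rmax_shift th t : 0 <= th -> 0 <= t <= 1 ->
  rmax (fun s => h s + 2 * Num.max 0 (K s - th)) t = Num.min (K t) th.
Proof.
move=> th0 t01; apply: rmax_eq => //.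
- exact: cont01D hc (shift_cont 2 th).
- move=> s st; have := @rmax_ge R h hc s s; have := @rmax_mono R h hc s t.
  by have [H|H] := leP 0 (K s - th); have [H'|H'] := leP (K t) th; lra.
have [Kt|Kt] := leP (K t) th.
  have [s st E] := rmax_ex hc t01; exists s => //.
  have Kst : K s <= K t by apply: (rmax_mono hc); lra.
  by rewrite max_l; lra.
have [|||tau [tau01 htau Ktau before]] := @rmax_first R h hc th; rewrite ?h0 //; try lra.
  by have := @rmax_mono R h hc t 1; lra.
exists tau; last by rewrite htau Ktau subrr max_l // mulr0 addr0 opprK.
have [H|H] := leP tau t; first by lra.
by have := before t; have -> : 0 <= t < tau by [lra]; move=> /(_ isT); lra.
Qed.

(** Successive raising operators add up to a single shift, whose threshold goes down by one each
    time. *)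
Lemma raising_shift th t : 1 <= th -> th <= K 1 -> 0 <= t <= 1 ->
  Num.max 0 (K t - th) + raising (fun s => h s + 2 * Num.max 0 (K s - th)) t =
  Num.max 0 (K t - (th - 1)).
Proof.
move=> th1 thK t01.
have kc : cont01 (fun s => h s + 2 * Num.max 0 (K s - th)).
  exact: cont01D hc (shift_cont 2 th).
rewrite raisingE // !rmax_shift //; try lra.
have [H1|H1] := leP (K t) th; have [H2|H2] := leP (K 1) th;
 have [H3|H3] := leP 0 (K t - th); have [H4|H4] := leP 0 (K t - (th - 1));
 try (match goal with |- context [Num.max 0 ?x] => have [H5|H5] := leP 0 x end); lra.
Qed.

Lemma raising_cont : cont01 (raising h).
Proof.
apply: (cont01_ext (h := fun t => 1 * Num.max 0 (K t - (K 1 - 1)))).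
  by move=> t t01; rewrite raisingE // mul1r.
exact: shift_cont.
Qed.

Lemma lowering_raising t : 1 <= K 1 -> 0 <= t <= 1 ->
  lowering (fun s => h s + 2 * raising h s) t = raising h t.
Proof.
move=> K1 t01; set hq := fun s => _.
have hqc : cont01 hq by apply: cont01D => //; apply: cont01Z; exact: raising_cont.
have hqE s : 0 <= s <= 1 -> hq s = h s + 2 * Num.max 0 (K s - (K 1 - 1)).
  by move=> s01; rewrite /hq raisingE.
have Kq : rmax hq 1 = K 1 - 1.
  rewrite (rmax_ext hqE) ?rmax_shift ?min_r //; lra.
have Rt := raisingE hc t01.
have K1t : K t <= K 1 by apply: rmax_mono => //; lra.
have Rle1 : raising h t <= 1.
  by rewrite Rt; have [H|H] := leP 0 (K t - (K 1 - 1)); lra.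
apply/eqP; rewrite eq_le; apply/andP; split; last first.
  apply: le_lowering => // u tu; rewrite hqE ?Kq ?Rt; last by lra.
  have := @rmax_mono R h hc t u; have := @rmax_ge R h hc u u.
  by have [H|H] := leP 0 (K t - (K 1 - 1)); have [H'|H'] := leP 0 (K u - (K 1 - 1)); lra.
have [KK|KK] := eqVneq (K t) (K 1).
  apply: le_trans (lowering_le1 hqc t01) _; rewrite Rt KK.
  by rewrite max_r; lra.
have {}KK : K t < K 1 by rewrite lt_neqAle KK.
(* The future minimum is bounded by the value at [sg], the last time when [K] is at the larger of
   its present level and the threshold [K 1 - 1]; there [h = - K]. *)
pose th := Num.max (K t) (K 1 - 1).
have thK : th < K 1 by rewrite gt_max KK; lra.
have Kth : K t <= th by rewrite le_max lexx.
have kth : K 1 - 1 <= th by rewrite le_max lexx orbT.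
have [||sg [sg01 hsg Ksg after]] := @rmax_last R h hc th; rewrite ?h0 //; try lra.
have tsg : t <= sg.
  rewrite leNgt; apply/negP => sgt; have := after t; have -> : sg < t <= 1 by lra.
  by move=> /(_ isT); lra.
apply: le_trans (lowering_le (u := sg) hqc t01 _) _; first by lra.
rewrite hqE // hsg Ksg Kq Rt; move: Kth kth; rewrite /th.
have [H|H] := leP (K t) (K 1 - 1) => _ _.
  by rewrite !max_l; lra.
by rewrite !max_r; lra.
Qed.

Lemma rmax_lowered : lowering h 1 = 1 ->
  rmax (fun s => h s - 2 * lowering h s) 1 = K 1 + 1.
Proof.
move=> L1; have t01 : 0 <= (1 : R) <= 1 by lra.
apply: rmax_eq => //.
- by apply: cont01D => //; apply: cont01N; apply: cont01Z; exact: lowering_cont.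
- move=> s s01; have := lowering_le (h := h) hc (t := s) (u := s).
  by have := lowering_le1 (h := h) hc (t := s); lra.
have [|s s01 [E1 E2]] := lowering_attained hc t01; first by rewrite L1.
by exists s => //; rewrite E2 L1; lra.
Qed.

Lemma raising_lowering t : lowering h 1 = 1 -> 0 <= t <= 1 ->
  raising (fun s => h s - 2 * lowering h s) t = lowering h t.
Proof.
move=> L1 t01; set hq := fun s => _.
have hqc : cont01 hq.
  by apply: cont01D => //; apply: cont01N; apply: cont01Z; exact: lowering_cont.
rewrite raisingE // rmax_lowered // addrK.
have L0 := lowering_ge0 hc t01.
have ub : rmax hq t <= K 1 + lowering h t.
  have [s st ->] := rmax_ex hqc t01; rewrite /hq.
  have := lowering_le (h := h) hc (t := s) (u := s).
  by have := lowering_mono (h := h) hc (s := s) (t := t); lra.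
have [Lt|Lt] := eqVneq (lowering h t) 0.
  by rewrite Lt in ub *; rewrite max_l //; lra.
have {}L0 : 0 < lowering h t by rewrite lt_neqAle eq_sym Lt.
have [s st [E1 E2]] := lowering_attained hc t01 L0.
have := @rmax_ge R hq hqc s t; rewrite {1}/hq E2 => lb.
by rewrite max_r; lra.
Qed.

End RaisingLoweringInverse.

(** * The invariant on the crystal of a dominant path *)

Section CrystalBound.
Variables (R : realType) (n r : nat) (g : kac_moody n r).
Hypothesis gsym : symmetrizable g.
Local Notation XR := 'cV[R]_r.
Implicit Types p q : R -> XR.

Definition height_fun p (i : 'I_n) (t : R) : R := pairing (p t) (scoroot g i).

Lemma Hfun_simple p i : Hfun g p (sroot g i) = height_fun p i.
Proof. by apply/funext => t; rewrite /Hfun coroot_simple. Qed.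

Lemma Hmin_simple p i : Hmin g p (sroot g i) = - rmax (height_fun p i) 1.
Proof. by rewrite /Hmin Hfun_simple inf_rmax. Qed.

Lemma e_coefE p i : e_coef g p i = raising (height_fun p i).
Proof.
apply/funext => t; rewrite /e_coef /raising /= Hfun_simple Hmin_simple.
by rewrite (opprK (rmax _ _)).
Qed.

Lemma f_coefE p i : f_coef g p i = lowering (height_fun p i).
Proof.
apply/funext => t; rewrite /f_coef /lowering /= Hfun_simple Hmin_simple.
by rewrite (opprK (rmax _ _)).
Qed.

Lemma pairing_simple i j : pairing (toXR R (sroot g i)) (scoroot g j) = (cartan g j i)%:~R.
Proof. by rewrite pairing_toXR cartan_pairing. Qed.

Lemma height_shift p c i j t : height_fun (fun t => p t + c t *: toXR R (sroot g i)) j t =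
  height_fun p j t + (cartan g j i)%:~R * c t.
Proof. by rewrite /height_fun pairingD pairingZ pairing_simple mulrC. Qed.

Lemma height_e p i j t : height_fun (e_op g i p) j t =
  height_fun p j t + (cartan g j i)%:~R * raising (height_fun p i) t.
Proof. by rewrite -e_coefE -height_shift. Qed.

Lemma height_f p i j t : height_fun (f_op g i p) j t =
  height_fun p j t - (cartan g j i)%:~R * lowering (height_fun p i) t.
Proof.
rewrite -f_coefE -mulrN -(height_shift p (fun t => - f_coef g p i t)).
by rewrite /f_op /height_fun /= (scaleNr (f_coef g p i t)).
Qed.

(** Continuity and origin as seen by the simple coroots; in this form they pass through the root
    operators and both reparametrization clauses. *)
Definition good p := forall j, cont01 (height_fun p j) /\ height_fun p j 0 = 0.

Definition eq01 p q := forall t, 0 <= t <= 1 -> p t = q t.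

Lemma good_ext p q : eq01 p q -> good p -> good q.
Proof.
move=> E gp j; have [jc j0] := gp j; split.
  by apply: cont01_ext jc => t t01; rewrite /height_fun E.
by rewrite /height_fun -E; [exact: j0|rewrite lexx ler01].
Qed.

Section Simple.
Variables (p : R -> XR) (i : 'I_n).
Hypothesis gp : good p.
Let hc := (gp i).1.
Let h0 := (gp i).2.
Local Notation K := (rmax (height_fun p i)).

Lemma e_definedE : e_defined g p i <-> 1 <= K 1.
Proof.
rewrite /e_defined e_coefE raisingE ?lexx ?ler01 // rmax0 // h0 oppr0 lt_max ltxx /=.
rewrite leNgt; split=> [/negP|H]; first by rewrite -leNgt; lra.
by apply/negP; rewrite -leNgt; lra.
Qed.

Lemma f_definedE : f_defined g p i <-> lowering (height_fun p i) 1 = 1.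
Proof.
rewrite /f_defined f_coefE; have := lowering_le1 hc (t := 1).
rewrite ler01 lexx => /(_ isT) L1; split=> [/negP|->]; last by rewrite ltxx.
by rewrite -leNgt => L; apply/eqP; rewrite eq_le L1.
Qed.

Lemma good_e : e_defined g p i -> good (e_op g i p).
Proof.
move=> /e_definedE K1 j; have [jc j0] := gp j; split.
  apply: (cont01_ext (h := fun t => height_fun p j t +
      (cartan g j i)%:~R * raising (height_fun p i) t)).
    by move=> t _; rewrite height_e.
  by apply: cont01D => //; apply: cont01Z; exact: raising_cont.
rewrite height_e j0 raisingE ?lexx ?ler01 // rmax0 // h0 max_l ?mulr0 ?addr0 //.
by rewrite oppr0; lra.
Qed.

Lemma good_f : good (f_op g i p).
Proof.
move=> j; have [jc j0] := gp j; split.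
  apply: (cont01_ext (h := fun t => height_fun p j t -
      (cartan g j i)%:~R * lowering (height_fun p i) t)).
    by move=> t _; rewrite height_f.
  by apply: cont01D => //; apply: cont01N; apply: cont01Z; exact: lowering_cont.
by rewrite height_f j0 lowering0 // mulr0 subr0.
Qed.

Lemma height_e2 : height_fun (e_op g i p) i =
  (fun t => height_fun p i t + 2 * raising (height_fun p i) t).
Proof. by apply/funext => t; rewrite height_e cartan_diag. Qed.

Lemma height_f2 : height_fun (f_op g i p) i =
  (fun t => height_fun p i t - 2 * lowering (height_fun p i) t).
Proof. by apply/funext => t; rewrite height_f cartan_diag. Qed.

Lemma f_defined_e : e_defined g p i -> f_defined g (e_op g i p) i.
Proof.
move=> /e_definedE K1; rewrite /f_defined f_coefE height_e2.
rewrite lowering_raising ?lexx ?ler01 // raisingE ?lexx ?ler01 // subKr.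
by rewrite max_r ?ler01 // ltxx.
Qed.

Lemma f_e_op : e_defined g p i -> eq01 (f_op g i (e_op g i p)) p.
Proof.
move=> /e_definedE K1 t t01; rewrite /f_op f_coefE height_e2 lowering_raising //.
by rewrite /e_op e_coefE addrK.
Qed.

Lemma e_defined_f : f_defined g p i -> e_defined g (f_op g i p) i.
Proof.
move=> /f_definedE L1; rewrite /e_defined e_coefE height_f2.
by rewrite raising_lowering ?lexx ?ler01 // lowering0 // ltxx.
Qed.

Lemma e_f_op : f_defined g p i -> eq01 (e_op g i (f_op g i p)) p.
Proof.
move=> /f_definedE L1 t t01; rewrite /e_op e_coefE height_f2 raising_lowering //.
by rewrite /f_op f_coefE subrK.
Qed.

End Simple.

Local Notation reach_ p := (reach (dual_cartan g) (fun=> 1%N) (height_fun p)).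

(** A shift by 1 with [c] constantly 1 gains exactly 1. The heights change by column [i] of the
    Cartan matrix, hence the transposed matrix in [reach_]. *)
Lemma reach_e p i z : good p -> e_defined g p i ->
  (reach_ p z -> reach_ (e_op g i p) (z + 1)) /\
  (reach_ (e_op g i p) z -> reach_ p (z - 1)).
Proof.
move=> gp /(e_definedE i gp) K1; have [hc h0] := gp i.
have E j t : 0 <= t <= 1 -> height_fun (e_op g i p) j t =
    Hshift (dual_cartan g) (height_fun p) i (rmax (height_fun p i) 1 - 1) j t.
  by move=> t01; rewrite height_e raisingE.
split=> [rz|rz].
  apply: (reach_ext (H := Hshift (dual_cartan g) (height_fun p) i
    (rmax (height_fun p i) 1 - 1))) => [j t t01|]; first by rewrite E.
  have := reach_raise (@dual_cartan_diag _ _ g) (@dual_cartan_offdiag _ _ g)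
    (@dual_cartan_zero _ _ g) hc h0 ltr01 K1 rz.
  by rewrite mulr1.
have := reach_lower (@dual_cartan_diag _ _ g) (@dual_cartan_offdiag _ _ g)
  (@dual_cartan_zero _ _ g) hc h0 ltr01 K1 (reach_ext E rz).
by rewrite mulr1.
Qed.

(** The invariant of [p0] is at most that of [q] plus [D]. Along [crystal], [D] counts lowering
    minus raising operators, that is the height of [p0 1 - q 1]. *)
Definition bounded_over p0 q (D : int) :=
  forall z, reach_ q z -> reach_ p0 (z + D%:~R).

Lemma bounded_over_ext p0 q q' D : eq01 q q' -> bounded_over p0 q D -> bounded_over p0 q' D.
Proof.
move=> E b z rz; apply: b; apply: reach_ext rz => i t t01.
by rewrite /height_fun E.
Qed.

Lemma bounded_over_e p0 q i D : good q -> e_defined g q i ->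
  bounded_over p0 q D -> bounded_over p0 (e_op g i q) (D - 1).
Proof.
move=> gq dq b z /(reach_e z gq dq).2 /b.
by rewrite intrB -addrA [- _ + _]addrC.
Qed.

Lemma bounded_over_f p0 q i D : good q -> f_defined g q i ->
  bounded_over p0 q D -> bounded_over p0 (f_op g i q) (D + 1).
Proof.
move=> gq dq b z.
move=> /(reach_e z (good_f i gq) (e_defined_f gq dq)).1 rz.
have /b : reach_ q (z + 1).
  by apply: reach_ext rz => j t t01; rewrite /height_fun e_f_op.
by rewrite intrD -addrA [1 + _]addrC.
Qed.

(** The empty word costs 0 on [q], and every word costs at least 0 on the dominant [p0]. *)
Lemma bounded_over_ge0 p0 q D : dominant_path g p0 -> bounded_over p0 q D -> 0 <= D.
Proof.
move=> dp0 b; have := b 0 (reach_nil _ _ _); rewrite add0r => /reach_ge0.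
rewrite ler0z; apply=> i t t01.
by apply: dp0; rewrite in_itv.
Qed.

Lemma eq01_reparametrizes q q' : eq01 q q' -> reparametrizes q q'.
Proof.
move=> E; exists id; last by move=> t; rewrite in_itv /= => t01; exact: E.
split; first by [].
- by rewrite image_id.
- by apply/cont01P => t _ e e0; exists e.
Qed.

Lemma crystal_bounded p0 q : good p0 -> crystal g p0 q ->
  good q /\ exists D, bounded_over p0 q D.
Proof.
move=> gp0; elim=> {q}.
- by split=> //; exists 0 => z; rewrite addr0.
- move=> q q' _ [gq [D b]] [phi /is_reparam_onto mphi E].
  have {}E t : 0 <= t <= 1 -> q' t = q (phi t) by move=> t01; apply: E; rewrite in_itv.
  have [_ p01 pm ps] := mphi.
  split.
    move=> j; have [jc j0] := gq j; split.
      apply: (cont01_ext (h := fun t => height_fun q j (phi t))).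
        by move=> t t01; rewrite /height_fun E.
      exact: cont01_comp.
    rewrite /height_fun E ?lexx ?ler01 //; suff -> : phi 0 = 0 by [].
    have [|s s01 s0] := ps 0; first by rewrite lexx ler01.
    have := pm 0 s; have := p01 0; rewrite s0 lexx ler01; lra.
  exists D => z rz; apply: b.
  apply: (reach_reparam (H := height_fun q') pm p01) rz => i t t01.
  by rewrite /height_fun E.
- move=> q q' _ [gq [D b]] [phi /is_reparam_onto mphi E].
  have {}E t : 0 <= t <= 1 -> q t = q' (phi t) by move=> t01; apply: E; rewrite in_itv.
  have [_ p01 pm ps] := mphi.
  have phi0 : phi 0 = 0.
    have [|s s01 s0] := ps 0; first by rewrite lexx ler01.
    have := pm 0 s; have := p01 0; rewrite s0 lexx ler01; lra.
  split.
    move=> j; have [jc j0] := gq j; split.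
      apply: (cont01_quotient mphi); apply: cont01_ext jc => t t01.
      by rewrite /height_fun E.
    by have := j0; rewrite /height_fun E ?phi0 // lexx ler01.
  (* A section of [phi], possibly discontinuous but monotone, which is what transporting timed words
     requires. *)
  pose gs t := xget 0 [set s | 0 <= s <= 1 /\ phi s = t].
  have gsP t : 0 <= t <= 1 -> 0 <= gs t <= 1 /\ phi (gs t) = t.
    move=> t01; apply: (@xgetPex _ 0 [set s | 0 <= s <= 1 /\ phi s = t]).
    by have [s s01 st] := ps t t01; exists s.
  exists D => z rz; apply: b.
  apply: (reach_reparam (H := height_fun q') (g := gs)) rz => [s t s01 t01 st|t t01|i t t01].
  - have [gs01 gsE] := gsP s s01; have [gt01 gtE] := gsP t t01.
    rewrite leNgt; apply/negP => lt; have := pm _ _ gt01 gs01 (ltW lt).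
    rewrite gsE gtE => ts; have E' : s = t by apply/eqP; rewrite eq_le st.
    by rewrite E' ltxx in lt.
  - by have [] := gsP t t01.
  - by have [gt01 gtE] := gsP t t01; rewrite /height_fun E // gtE.
- move=> i q _ [gq [D b]] dq; split; first exact: good_f.
  by exists (D + 1); exact: bounded_over_f.
- move=> i q _ [gq [D b]] dq; split; first exact: good_e.
  by exists (D - 1); exact: bounded_over_e.
Qed.

Lemma crystal_ext P q q' : eq01 q q' -> crystal g P q -> crystal g P q'.
Proof. by move=> /eq01_reparametrizes E c; exact: crystal_unreparam c E. Qed.

Lemma crystal_e_back P q i : good q -> e_defined g q i ->
  crystal g P (e_op g i q) -> crystal g P q.
Proof.
move=> gq dq /crystal_f/(_ (f_defined_e gq dq)).
by apply: crystal_ext; exact: f_e_op.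
Qed.

(** [q] is the closed form of [k] raising operators applied to [p], by [raising_shift]; lowering
    operators lead back from [q] to [p]. *)
Lemma raise_chain p0 p i D k : good p -> k%:R <= rmax (height_fun p i) 1 ->
  bounded_over p0 p D ->
  let q := fun t => p t + Num.max 0 (rmax (height_fun p i) t -
    (rmax (height_fun p i) 1 - k%:R)) *: toXR R (sroot g i) in
  [/\ good q, bounded_over p0 q (D - k%:Z)
    & forall P, crystal g P q -> crystal g P p].
Proof.
move=> gp kK b; have [hc h0] := gp i; set K := rmax (height_fun p i) in kK *.
pose q_ j t := p t + Num.max 0 (K t - (K 1 - j%:R)) *: toXR R (sroot g i).
suff H j : (j <= k)%N ->
    [/\ good (q_ j), bounded_over p0 (q_ j) (D - j%:Z)
      & forall P, crystal g P (q_ j) -> crystal g P p].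
  exact: H (leqnn k).
elim: j => [|j IH] jk.
  have E : eq01 p (q_ 0%N).
    move=> t t01; rewrite /q_ subr0 max_l ?scale0r ?addr0 // subr_le0.
    by apply: (rmax_mono hc); lra.
  rewrite subr0; split; [exact: good_ext gp|exact: bounded_over_ext b|].
  by move=> P; apply: crystal_ext => t t01; rewrite E.
have [gq bq cq] := IH (ltnW jk).
have jK : j%:R + 1 <= K 1.
  by rewrite natr1; apply: le_trans kK; rewrite ler_nat.
have hE t : height_fun (q_ j) i t =
    height_fun p i t + 2 * Num.max 0 (K t - (K 1 - j%:R)).
  by rewrite /q_ (height_shift p (fun t => Num.max 0 (K t - (K 1 - j%:R)))) cartan_diag.
have {}hE : height_fun (q_ j) i = fun t => height_fun p i t + 2 * Num.max 0 (K t - (K 1 - j%:R)).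
  by apply/funext.
have j0 : 0 <= j%:R :> R by rewrite ler0n.
have dq : e_defined g (q_ j) i.
  apply/(e_definedE i gq); rewrite hE rmax_shift ?lexx ?ler01 //; last by lra.
  by rewrite -/K min_r; lra.
have E : eq01 (e_op g i (q_ j)) (q_ j.+1).
  have th1 : 1 <= K 1 - j%:R by lra.
  have thK : K 1 - j%:R <= K 1 by lra.
  move=> t t01; rewrite /e_op e_coefE hE /q_ -addrA -scalerDl.
  rewrite (raising_shift hc h0 th1 thK t01).
  by congr (_ + Num.max 0 (_ - _) *: _); rewrite -natr1; ring.
split.
- by apply: good_ext E _; exact: good_e.
- apply: bounded_over_ext E _; have -> : D - j.+1%:Z = D - j%:Z - 1 by lia.
  exact: bounded_over_e.
move=> P c; apply: cq; apply: crystal_e_back gq dq _; apply: crystal_ext c => t t01.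
by rewrite E.
Qed.

End CrystalBound.


(** * Paths with sign-definite height functions *)
Section SignDefinitePaths.
Variables (R : realType) (n r : nat) (g : kac_moody n r).
Hypothesis gsym : symmetrizable g.
Local Notation XR := 'cV[R]_r.
Implicit Types p q : R -> XR.

Lemma pairing_bound (bv : 'rV[int]_r) :
  exists2 C : R, 0 <= C & forall x : XR, `|pairing x bv| <= C * `|x|.
Proof.
exists (\sum_k `|(bv 0 k)%:~R|); first by apply: sumr_ge0.
move=> x; rewrite /pairing mxE mulr_suml.
apply: le_trans (ler_norm_sum _ _ _) _; apply: ler_sum => k _.
rewrite mxE normrM ler_wpM2l //.
rewrite [leRHS]/Num.norm /= mx_normrE.
exact: (@le_bigmax _ _ _ 0 (fun ij : 'I_r * 'I_1 => `|x ij.1 ij.2|) (k, 0)).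
Qed.

Lemma pairingB (x y : XR) bv : pairing (x - y) bv = pairing x bv - pairing y bv.
Proof. by rewrite pairingD -scaleN1r pairingZ mulN1r. Qed.

Lemma is_path_good p : is_path p -> good g p.
Proof.
move=> [/cont01P pc _ p0 _] j; split; last by rewrite /height_fun p0 /pairing mulmx0 mxE.
have [C C0 HC] := pairing_bound (scoroot g j).
by apply: (cont01_lip (C := C) pc) => s t _ _; rewrite -pairingB.
Qed.

Lemma weyl_act_srefl i (x : XR) :
  weyl_act (srefl g i) x = x - pairing x (scoroot g i) *: toXR R (sroot g i).
Proof.
rewrite /weyl_act /srefl map_mxB map_mx1 map_mxM mulmxBl mul1mx -mulmxA.
by rewrite [map_mx _ (scoroot g i) *m x]mx11_scalar mul_mx_scalar.
Qed.

Definition fold_path p (i : 'I_n) (t : R) : XR :=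
  p t + Num.max 0 (- height_fun g p i t) *: toXR R (sroot g i).

Lemma max0_lip (x y : R) : `|Num.max 0 x - Num.max 0 y| <= `|x - y|.
Proof.
have [H1|H1] := leP 0 x; have [H2|H2] := leP 0 y;
  have := ler_norm (x - y); have := ler_norm (y - x); rewrite [`|y - x|]distrC => H3 H4;
  rewrite ler_norml; lra.
Qed.

Lemma fold_path_lip p i :
  exists2 C, 0 <= C & forall s t, `|fold_path p i s - fold_path p i t| <= C * `|p s - p t|.
Proof.
have [C C0 HC] := pairing_bound (scoroot g i).
exists (1 + C * `|toXR R (sroot g i)|) => [|s t]; first by rewrite addr_ge0 ?mulr_ge0.
rewrite /fold_path opprD addrACA -scalerBl mulrDl mul1r.
apply: le_trans (ler_normD _ _) _; rewrite lerD2l normrZ mulrAC ler_wpM2r //.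
apply: le_trans (max0_lip _ _) _.
by rewrite -opprD normrN /height_fun -pairingB.
Qed.

Lemma is_path_fold p i : is_path p -> height_fun g p i 1 <= 0 ->
  is_path (fold_path p i).
Proof.
move=> [/cont01P pc [M pM] p0 [x p1]] h1.
have [C C0 HC] := fold_path_lip p i; split.
- by apply/cont01P; apply: (cont01_lip (C := C) pc) => s t _ _.
- exists (C * M) => s ps; apply: le_trans (ler_wpM2l C0 (pM s ps)).
  by rewrite mulr_sumr; apply: ler_sum => k _; exact: HC.
- by rewrite /fold_path /height_fun p0 /pairing mulmx0 mxE oppr0 max_l // scale0r addr0.
exists (srefl g i *m x); rewrite /fold_path max_r ?oppr_ge0 //.
rewrite scaleNr -weyl_act_srefl p1 /weyl_act /toXR map_mxM.
by [].
Qed.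

Definition sign_definite p := forall b : 'cV[int]_r, pos_real_root g b ->
  (forall t : R, 0 <= t <= 1 -> 0 <= Hfun g p b t) \/
  (exists t0 : R, [/\ 0 <= t0 < 1,
     (forall t : R, 0 <= t <= t0 -> 0 <= Hfun g p b t),
     (forall t : R, t0 < t <= 1 -> Hfun g p b t < 0)
   & (forall s t : R, t0 < s -> s <= t -> t <= 1 -> Hfun g p b t <= Hfun g p b s)]).

(** * Folding along a simple root *)

Section Fold.
Variables (p : R -> XR) (i : 'I_n).
Hypothesis gp : good g p.
Hypothesis sp : sign_definite p.
Hypothesis h1 : height_fun g p i 1 < 0.
Local Notation h := (height_fun g p i).

Lemma fold_time : exists t0, [/\ 0 <= t0 < 1,
  (forall t, 0 <= t <= t0 -> 0 <= h t), (forall t, t0 < t <= 1 -> h t < 0),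
  (forall s t, t0 < s -> s <= t -> t <= 1 -> h t <= h s) & h t0 = 0].
Proof.
have h1' := h1; have := sp (pos_real_root_simple g i); rewrite (Hfun_simple gsym).
case=> [/(_ 1)|[t0 [t01 hp hn hm]]]; first by rewrite lexx ler01 => /(_ isT); lra.
exists t0; split=> //; apply/eqP; rewrite eq_le hp ?andbT; last by lra.
rewrite leNgt; apply/negP => ht0; have [hc _] := gp i.
have [|d d0 dh] := hc t0 _ (h t0) ht0; first by lra.
pose m := Num.min (d / 2) (1 - t0).
have mpos : 0 < m by rewrite lt_min; lra.
have m1 : m <= d / 2 by rewrite ge_min lexx.
have m2 : m <= 1 - t0 by rewrite ge_min lexx orbT.
have := dh (t0 + m); have -> : 0 <= t0 + m <= 1 by lra.
have -> : t0 + m - t0 = m by ring.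
rewrite gtr0_norm // => /(_ isT); have -> : m < d by lra.
move=> /(_ isT); have := hn (t0 + m); have -> : t0 < t0 + m <= 1 by lra.
by move=> /(_ isT) H; rewrite ler0_norm; lra.
Qed.

(** After [t0] the height is non-increasing, so its running minimum is its current value. This is
    what identifies the iterated [e_i] with the fold. *)
Lemma fold_rmax t : 0 <= t <= 1 -> rmax h t = Num.max 0 (- h t).
Proof.
have [t0 [t0_01 hp hn hm ht0]] := fold_time; have [hc h0] := gp i.
move=> t01; apply: (rmax_eq hc t01) => [s st|].
  have [st0|t0s] := leP s t0.
    by have := hp s; have -> : 0 <= s <= t0 by [lra]; move=> /(_ isT) H; rewrite le_max; apply/orP; left; lra.
  by have := hm s t t0s; rewrite le_max => H; apply/orP; right; lra.
have [H|H] := leP 0 (- h t); first by exists t; lra.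
by exists 0; [lra|rewrite h0 oppr0].
Qed.

Lemma Hfun_fold b t : Hfun g (fold_path p i) b t =
  Hfun g p b t + Num.max 0 (- h t) * ((coroot g b *m sroot g i) 0 0)%:~R.
Proof. by rewrite /Hfun /fold_path pairingD pairingZ pairing_toXR. Qed.

Lemma Hfun_srefl b t : real_root g b -> Hfun g p (srefl g i *m b) t =
  Hfun g p b t - h t * ((coroot g b *m sroot g i) 0 0)%:~R.
Proof.
move=> rb; rewrite /Hfun (coroot_srefl gsym) // srefl_rowE /pairing.
rewrite map_mxB map_mxZ mulmxBl -scalemxAl mxE [X in _ + X]mxE [X in _ - X]mxE.
by rewrite [X in _ - X]mulrC.
Qed.

(** For [b] other than [sr i], the height of the fold along [b] is that of [p] along [b] up to [t0],
    and along the positive root [s_i b] afterwards. Both agree at [t0], where [h] vanishes, and the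
    sign of the common value decides which of the two turning times remains. *)
Lemma sign_definite_fold : sign_definite (fold_path p i).
Proof.
have [t0 [t0_01 hp hn hm ht0]] := fold_time.
move=> b pb; have [bi|bi] := pselect (b = sroot g i).
  left=> t t01; rewrite bi Hfun_fold coroot_simple // pairing_diag.
  rewrite -/(Hfun g p _ t) (Hfun_simple gsym).
  by have [H|H] := leP 0 (- h t); lra.
have rb := pb.1; set b' := srefl g i *m b.
have pb' : pos_real_root g b' by exact: pos_real_root_srefl.
have E1 t : 0 <= t <= t0 -> Hfun g (fold_path p i) b t = Hfun g p b t.
  move=> tt0; rewrite Hfun_fold max_l ?mul0r ?addr0 // oppr_le0.
  exact: hp.
have E2 t : t0 < t <= 1 -> Hfun g (fold_path p i) b t = Hfun g p b' t.
  move=> tt0; rewrite Hfun_fold Hfun_srefl // max_r ?mulNr // oppr_ge0.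
  by apply: ltW; exact: hn.
have E0 : Hfun g p b t0 = Hfun g p b' t0 by rewrite Hfun_srefl // ht0 mul0r subr0.
have [Hb|Hb] := leP 0 (Hfun g p b t0).
  have bpos t : 0 <= t <= t0 -> 0 <= Hfun g p b t.
    move=> tt0; case: (sp pb) => [H|[u [u01 up un _]]]; first by apply: H; lra.
    have [ut|tu] := leP t u; first by apply: up; lra.
    by have := un t0; have -> : u < t0 <= 1 by [lra]; move=> /(_ isT); lra.
  case: (sp pb') => [H|[u [u01 up un um]]].
    left=> t t01; have [tt0|t0t] := leP t t0.
      by rewrite E1; [apply: bpos; lra|lra].
    by rewrite E2; [apply: H; lra|lra].
  have t0u : t0 <= u.
    rewrite leNgt; apply/negP => ut0; have := un t0; have -> : u < t0 <= 1 by lra.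
    by move=> /(_ isT); rewrite -E0; lra.
  right; exists u; split=> // [t tu|t ut|s t us st t1].
  - have [tt0|t0t] := leP t t0; first by rewrite E1; [apply: bpos; lra|lra].
    by rewrite E2; [apply: up; lra|lra].
  - by rewrite E2; [apply: un; lra|lra].
  - rewrite !E2; [|lra|lra]; exact: um.
(* Both heights are negative at [t0], so each is already past its turning time there and the two
   decreasing pieces join. *)
case: (sp pb) => [/(_ t0)|[u [u01 up un um]]].
  by have -> : 0 <= t0 <= 1 by [lra]; move=> /(_ isT); lra.
have ut0 : u < t0 by rewrite ltNge; apply/negP => t0u; have := up t0; have -> : 0 <= t0 <= u by [lra]; move=> /(_ isT); lra.
case: (sp pb') => [/(_ t0)|[u' [u'01 up' un' um']]].
  by have -> : 0 <= t0 <= 1 by [lra]; move=> /(_ isT); rewrite -E0; lra.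
have ut0' : u' < t0.
  rewrite ltNge; apply/negP => t0u; have := up' t0; have -> : 0 <= t0 <= u' by lra.
  by move=> /(_ isT); rewrite -E0; lra.
right; exists u; split=> // [t tu|t ut|s t us st t1].
- by rewrite E1; [apply: up|lra].
- have [tt0|t0t] := leP t t0; first by rewrite E1; [apply: un; lra|lra].
  by rewrite E2; [apply: un'; lra|lra].
have [tt0|t0t] := leP t t0; first by rewrite !E1; [apply: um; lra|lra|lra].
rewrite E2; last by lra.
have [st0|t0s] := leP s t0; last by rewrite E2; [apply: um'; lra|lra].
rewrite E1; last by lra.
have H1 : Hfun g p b t0 <= Hfun g p b s by apply: um; lra.
have H2 : Hfun g p b' t <= Hfun g p b' t0 by apply: um'; lra.
by rewrite -E0 in H2; exact: le_trans H2 H1.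
Qed.

End Fold.

Lemma sign_definite_dominant p : sign_definite p ->
  (forall i, 0 <= height_fun g p i 1) -> dominant_path g p.
Proof.
move=> sp h1 t; rewrite in_itv /= => t01 i.
have := sp _ (pos_real_root_simple g i); rewrite (Hfun_simple gsym).
case=> [H|[t0 [t0_01 _ hn _]]]; first exact: H.
have H : height_fun g p i 1 < 0.
  by apply: hn; apply/andP; split; [case/andP: t0_01|exact: lexx].
by have := h1 i; rewrite leNgt H.
Qed.

Lemma weyl_actM w v (x : XR) : weyl_act (w *m v) x = weyl_act w (weyl_act v x).
Proof. by rewrite /weyl_act map_mxM mulmxA. Qed.

Lemma weyl_act1 (x : XR) : weyl_act 1%:M x = x.
Proof. by rewrite /weyl_act map_mx1 mul1mx. Qed.

(* Folding by [i] is [k] raising steps, so it lowers the bound [D] by [k]. *)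
Lemma sign_definite_extremal p0 p (D : int) : dominant_path g p0 ->
  is_path p -> sign_definite p -> bounded_over g p0 p D -> extremal_path g p.
Proof.
move=> dp0 ip sp bp.
have [m mE] : exists m : nat, D < m%:Z by exists `|D|.+1; lia.
elim: m D p ip sp bp mE => [|m IH] D p ip sp bp Dm.
  by have := bounded_over_ge0 dp0 bp; lia.
have [dom|/existsNP[i /negP]] := pselect (forall i, 0 <= height_fun g p i 1).
  exists p; last by exists 1%:M; [exact: weyl1|rewrite weyl_act1].
  by split=> //; [exact: sign_definite_dominant|exact: crystal_self].
rewrite -ltNge => h1; have gp := is_path_good ip.
have [_ _ _ [x p1]] := ip.
have hx : height_fun g p i 1 = ((scoroot g i *m x) 0 0)%:~R.
  by rewrite /height_fun p1 pairing_toXR.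
(* An integer because [p 1] is in the lattice. It equals [rmax] at 1, so after [k] steps the
   threshold is 0 and the whole fold is reached. *)
pose k := `|((scoroot g i *m x) 0 0)%R|%N.
have x0 : (scoroot g i *m x) 0 0 < 0 by rewrite hx ltrz0 in h1.
have kE : k%:R = - height_fun g p i 1.
  by rewrite hx -intrN pmulrn; congr (_%:~R); rewrite /k; lia.
have K1 : rmax (height_fun g p i) 1 = k%:R.
  by rewrite fold_rmax ?lexx ?ler01 // max_r // ?kE // oppr_ge0 ltW.
have kK : k%:R <= rmax (height_fun g p i) 1 by rewrite K1.
have [_ bq cq] := raise_chain gsym (i := i) gp kK bp.
set q := (X in bounded_over _ _ X) in bq cq.
have E : eq01 q (fold_path p i).
  move=> t t01; rewrite /q K1 subrr subr0 /fold_path fold_rmax //.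
  by rewrite max_r // le_max lexx.
have [pm [ipm dpm cpm] [u Wu uE]] : extremal_path g (fold_path p i).
  apply: (IH (D - k%:Z)); last by rewrite /k; lia.
  - by apply: is_path_fold => //; exact: ltW.
  - exact: sign_definite_fold.
  - exact: bounded_over_ext E bq.
exists pm.
  split=> //; apply: cq; apply: crystal_ext cpm => t t01; exact/esym/E.
exists (srefl g i *m u); first by apply: weylM => //; exact: weyl_srefl.
(* [p 1] is the image under [s_i] of the endpoint of the fold. *)
rewrite weyl_actM -uE /fold_path max_r; last by rewrite oppr_ge0 ltW.
by rewrite scaleNr -weyl_act_srefl -weyl_actM srefl_sq weyl_act1.
Qed.

End SignDefinitePaths.

Theorem mainTheorem3 (R : realType) (n r : nat) (g : kac_moody n r)
    (p : R -> 'cV[R]_r) :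
  symmetrizable g ->
  is_path p ->
  (exists p0, dominant_source g p p0) ->
  (forall b : 'cV[int]_r, pos_real_root g b ->
     (forall t : R, 0 <= t <= 1 -> 0 <= Hfun g p b t) \/
     (exists t0 : R, [/\ 0 <= t0 < 1,
        (forall t : R, 0 <= t <= t0 -> 0 <= Hfun g p b t),
        (forall t : R, t0 < t <= 1 -> Hfun g p b t < 0)
      & (forall s t : R, t0 < s -> s <= t -> t <= 1 ->
           Hfun g p b t <= Hfun g p b s)])) ->
  extremal_path g p /\
  (forall w : 'M[int]_r, min_dominating g (p 1) w ->
     inversion_set g w = [set b | pos_real_root g b /\ Hfun g p b 1 < 0]).
Proof.
move=> gsym ip [p0 [ip0 dp0 cp]] sp; split; last first.
  by move=> w; exact: inversion_set_min.
have [_ [D bD]] := crystal_bounded gsym (is_path_good g ip0) cp.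
exact: sign_definite_extremal dp0 ip sp bD.
Qed.
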